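(* Let $\ell\ge 2$, let $S=\mathbb{R}[x_1,\dots,x_\ell]$, and let $m=2$, so that $\Lambda=\{(\lambda_1,\lambda_2)\in\mathbb{Z}^2\mid \ell-2\ge\lambda_1\ge\lambda_2\ge 0\}$. (1) The set $C_{\mathcal{A}}:=\{\eta^{\mathcal{A}}_i\mid i=1,\dots,\ell\}\cup\{\theta^{\mathcal{A}}_\lambda\mid\lambda\in\Lambda\}$ forms an $S$-basis for $D^{(2)}(\mathcal{A}_{\ell-1})$. Hence, as multisets, $$\exp D^{(2)}(\mathcal{A}_{\ell-1})=\{\underbrace{\ell-1,\dots,\ell-1}_{\ell}\}\cup\{|\lambda|\mid\lambda\in\Lambda\}.$$ (2) The set $C_{\mathcal{B}}:=\{\eta^{\mathcal{B}}_i\mid i=1,\dots,\ell\}\cup\{\theta^{\mathcal{B}}_\lambda\mid\lambda\in\Lambda\}$ forms an $S$-basis for $D^{(2)}(\mathcal{B}_{\ell})$. Hence, as multisets, $$\exp D^{(2)}(\mathcal{B}_{\ell})=\{\underbrace{2\ell-1,\dots,2\ell-1}_{\ell}\}\cup\{2|\lambda|+2\mid\lambda\in\Lambda\}.$$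
   Context: $S=\mathbb{R}[x_1,\dots,x_\ell]$, $\partial_i=\partial/\partial x_i$, and $D^{(m)}(S)=\bigoplus_{|\alpha|=m}S\,\partial^{\alpha}$ (sum over multi-indices $\alpha\in\mathbb{N}^\ell$ with $|\alpha|=\alpha_1+\cdots+\alpha_\ell=m$, $\partial^\alpha=\partial_1^{\alpha_1}\cdots\partial_\ell^{\alpha_\ell}$). A nonzero $\theta=\sum f_\alpha\partial^\alpha\in D^{(m)}(S)$ is homogeneous of degree $i$ if each $f_\alpha$ is zero or homogeneous of degree $i$. For a central hyperplane arrangement $\mathscr{A}$ in $\mathbb{R}^\ell$ with defining polynomial $Q(\mathscr{A})$ (product of one linear form per hyperplane), $D^{(m)}(\mathscr{A})=\{\theta\in D^{(m)}(S)\mid\theta(Q(\mathscr{A})S)\subseteq Q(\mathscr{A})S\}$. When $D^{(m)}(\mathscr{A})$ is a free $S$-module, $\exp D^{(m)}(\mathscr{A})$ denotes the multiset of degrees of a homogeneous basis. The arrangements are given by $Q(\mathcal{A}_{\ell-1})=\prod_{1\le i<j\le\ell}(x_i-x_j)$ and $Q(\mathcal{B}_\ell)=x_1\cdots x_\ell\prod_{1\le i<j\le\ell}(x_i^2-x_j^2)$. For $\alpha$ with $|\alpha|=m$, $x_\alpha=(x_1,\dots,x_1,x_2,\dots,x_2,\dots,x_\ell,\dots,x_\ell)$ with $x_i$ repeated $\alpha_i$ times, and $\alpha!=\alpha_1!\cdots\alpha_\ell!$. For $\lambda\in\Lambda$ put $|\lambda|=\lambda_1+\lambda_2$ and (with $m=2$)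 $$s^{\mathcal{A}}_\lambda(t_1,\dots,t_m)=\frac{\det(t_i^{\lambda_j+m-j})_{1\le i,j\le m}}{\det(t_i^{m-j})_{1\le i,j\le m}},\qquad s^{\mathcal{B}}_\lambda(t_1,\dots,t_m)=\frac{\det(t_i^{2(\lambda_j+m-j)+1})_{1\le i,j\le m}}{\det(t_i^{2(m-j)})_{1\le i,j\le m}},$$ which are symmetric polynomials. Define $$\theta^{\mathcal{A}}_\lambda=\sum_{|\alpha|=m}s^{\mathcal{A}}_\lambda(x_\alpha)\frac{1}{\alpha!}\partial^\alpha,\qquad \theta^{\mathcal{B}}_\lambda=\sum_{|\alpha|=m}s^{\mathcal{B}}_\lambda(x_\alpha)\frac{1}{\alpha!}\partial^\alpha,$$ $$\eta^{\mathcal{A}}_k=\Big(\prod_{i\ne k}(x_k-x_i)\Big)\frac{1}{m!}\partial_k^m,\qquad \eta^{\mathcal{B}}_k=\Big(x_k\prod_{i\ne k}(x_k^2-x_i^2)\Big)\frac{1}{m!}\partial_k^m\qquad(k=1,\dots,\ell).$$ *)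

(* Defs.v *)
From mathcomp Require Import all_boot all_order all_algebra.
From mathcomp Require Import classical_sets reals.
From mathcomp Require Import mpoly.

Set Implicit Arguments.
Unset Strict Implicit.
Unset Printing Implicit Defensive.

Import GRing.Theory.
Local Open Scope ring_scope.

(* Multi-indices alpha in N^l with |alpha| = m; every such alpha has degree
   less than m.+1, which makes this a finite type. *)
Definition midx (l m : nat) := {a : 'X_{1..l < m.+1} | mdeg a == m}.

Definition mexp l m (a : midx l m) : 'X_{1..l} := val (val a).

Definition mfact l m (a : midx l m) : nat := (\prod_(i < l) (mexp a i)`!)%N.

(* D^(m)(S) as the free S-module on the symbols d^alpha, |alpha| = m: the
   operator \sum_alpha f_alpha d^alpha is its family of coefficients. The
   codomain {mpoly R[l]}^o makes *: the multiplication by elements of S. *)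
Definition dop (R : realType) (l m : nat) :=
  {ffun midx l m -> {mpoly R[l]}^o}.

Section Operators.
Variables (R : realType) (l m : nat).
Local Notation S := {mpoly R[l]}.
Implicit Types (theta : dop R l m) (Q : S).

Definition dop_apply theta (f : S) : S :=
  \sum_(a : midx l m) (theta a : S) * f^`M[mexp a].

Definition dop_homog (d : nat) theta : Prop :=
  theta <> 0 /\ forall a, (theta a : S) \is d.-homog.

(* D^(m)(A) for an arrangement A with defining polynomial Q *)
Definition Dmod Q : set (dop R l m) :=
  [set theta | forall f : S, exists g : S, dop_apply theta (Q * f) = Q * g].

Definition is_basis (I : finType) (M : set (dop R l m)) (b : I -> dop R l m)
    : Prop :=
  [/\ forall i, M (b i),
      forall theta, M theta -> exists c : I -> S, theta = \sum_i c i *: b i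
    & forall c : I -> S, \sum_i c i *: b i = 0 -> forall i, c i = 0].

Definition is_homog_basis n (M : set (dop R l m))
    (b : 'I_n -> dop R l m) (d : 'I_n -> nat) : Prop :=
  is_basis M b /\ forall i, dop_homog (d i) (b i).

(* exp M = E, multisets being sequences up to permutation: M has a homogeneous
   basis, and the degrees of any homogeneous basis of M form E. *)
Definition is_exp (M : set (dop R l m)) (E : seq nat) : Prop :=
  (exists n (b : 'I_n -> dop R l m) (d : 'I_n -> nat), is_homog_basis M b d) /\
  (forall n (b : 'I_n -> dop R l m) (d : 'I_n -> nat),
     is_homog_basis M b d -> perm_eq (codom d) E).

End Operators.

Arguments Dmod {R l} m Q.

(* The tuple x_alpha, in which x_i is repeated alpha_i times. The sequence has
   length |alpha| = m, so the default value of nth is never used. *)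
Definition xpoint (R : realType) l m (a : midx l m) : m.-tuple {mpoly R[l]} :=
  [tuple nth 0 (flatten [seq nseq (mexp a i) 'X_i | i <- enum 'I_l]) j
  | j < m].

(* The exact quotient p / q, for q nonzero and dividing p; it must be taken
   before evaluation, since q may vanish at the points of interest. *)
Definition mpquot (R : realType) n (p q : {mpoly R[n]}) : {mpoly R[n]} :=
  xget 0 [set s | s * q = p]%classic.

Section Schur.
Variables (R : realType) (m : nat).

(* With indices starting at 0, the exponent lambda_j + m - j of the text
   becomes la j + (m - j.+1). *)
Definition schurA (la : 'I_m -> nat) : {mpoly R[m]} :=
  mpquot (\det (\matrix_(i < m, j < m) 'X_i ^+ (la j + (m - j.+1))))
         (\det (\matrix_(i < m, j < m) 'X_i ^+ (m - j.+1))).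

Definition schurB (la : 'I_m -> nat) : {mpoly R[m]} :=
  mpquot (\det (\matrix_(i < m, j < m) 'X_i ^+ (2 * (la j + (m - j.+1)) + 1)))
         (\det (\matrix_(i < m, j < m) 'X_i ^+ (2 * (m - j.+1)))).

End Schur.

Section Bases.
Variables (R : realType) (l m : nat).
Local Notation S := {mpoly R[l]}.

Definition dop_schur (s : {mpoly R[m]}) : dop R l m :=
  [ffun a => ((mfact a)%:R^-1 : R) *: (s \mPo xpoint R a : S)].

Definition thetaA (la : 'I_m -> nat) : dop R l m := dop_schur (schurA R la).
Definition thetaB (la : 'I_m -> nat) : dop R l m := dop_schur (schurB R la).

(* f * (1 / m!) * d_k^m *)
Definition dop_pow (f : S) (k : 'I_l) : dop R l m :=
  [ffun a => if mexp a == (U_(k) *+ m)%MM then (m`!%:R^-1 : R) *: f else 0].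

Definition etaA (k : 'I_l) : dop R l m :=
  dop_pow (\prod_(i < l | i != k) ('X_k - 'X_i)) k.
Definition etaB (k : 'I_l) : dop R l m :=
  dop_pow ('X_k * \prod_(i < l | i != k) ('X_k ^+ 2 - 'X_i ^+ 2)) k.

End Bases.

Definition QA (R : realType) (l : nat) : {mpoly R[l]} :=
  \prod_(i < l) \prod_(j < l | (i < j)%N) ('X_i - 'X_j).

Definition QB (R : realType) (l : nat) : {mpoly R[l]} :=
  (\prod_(i < l) 'X_i) *
  \prod_(i < l) \prod_(j < l | (i < j)%N) ('X_i ^+ 2 - 'X_j ^+ 2).

(* Pairs l - 2 >= lambda_1 >= lambda_2 >= 0; for l >= 2, membership in 'I_l.-1
   is the bound l - 2 >= lambda_j >= 0. *)
Definition Lambda (l : nat) :=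
  {la : {ffun 'I_2 -> 'I_l.-1} | (la ord_max <= la ord0)%N}.

Definition part l (la : Lambda l) : 'I_2 -> nat := fun j => val la j.

Definition psize l (la : Lambda l) : nat := (\sum_(j < 2) part la j)%N.

(* The union C of the eta_k and the theta_lambda, as an indexed family *)
Definition CA (R : realType) l (x : 'I_l + Lambda l) : dop R l 2 :=
  match x with inl k => etaA R 2 k | inr la => thetaA R l (part la) end.

Definition CB (R : realType) l (x : 'I_l + Lambda l) : dop R l 2 :=
  match x with inl k => etaB R 2 k | inr la => thetaB R l (part la) end.

(* Main.v *)
Require Import Defs.
From mathcomp Require Import all_boot all_order all_algebra.
From mathcomp Require Import all_fingroup ring.
From mathcomp Require Import classical_sets reals.
From mathcomp Require Import mpoly.

(* A second-order operator theta = 1/2 \sum g_ij d_i d_j is the same as a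
   symmetric matrix g over S. Since
     theta(Q f) = theta(Q) f + \sum_j (\sum_i g_ij d_i Q) d_j f + Q theta(f),
   theta preserves Q S iff each column of g is tangent to every hyperplane.
   With nodes y_i = x_i and weights w_i = 1 in type A, and y_i = x_i^2 and
   w_i = x_i in type B, Newton interpolation shows that v is tangent iff
   v_i = w_i P(y_i) for some P in S[t] of degree < l, and the generators become
   w_i w_j s_lambda(y_i, y_j) and diagonal matrices.

   Generation: changing the diagonal of g by multiples of the eta_k makes the
   polynomials P_j interpolating the columns of degree < l - 1. Reducing modulo
   the equation of a hyperplane, where l - 1 of the nodes stay distinct, shows
   that the coefficients of P_j are tangent in j, so that
   g_ij = w_i w_j \sum a_pq y_i^p y_j^q. Inverting a Vandermonde matrix, a is
   symmetric, hence of degree < l - 1 in both variables; multiplied by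
   y_i - y_j the sum becomes alternating, that is, a combination of the
   numerators of the Schur polynomials. Freeness follows from the same
   multiplication and a Vandermonde matrix.

   For the exponents, the constant terms of the change of basis between two
   homogeneous bases form an invertible matrix, and any nonzero term in the
   expansion of its determinant matches the degrees. *)

Set Implicit Arguments.
Unset Strict Implicit.
Unset Printing Implicit Defensive.

Import GRing.Theory Num.Theory.
Local Open Scope ring_scope.

Section Divisibility.
Variable S : comNzRingType.
Implicit Types a b c f : S.

Definition divides a b := exists c, b = a * c.

Lemma divides_prod (I : eqType) (r : seq I) (d : I -> S) f :
  uniq r ->
  (forall i j a, i \in r -> j \in r -> i != j ->
     divides (d i) (d j * a) -> divides (d i) a) ->
  (forall i, i \in r -> divides (d i) f) ->
  divides (\prod_(i <- r) d i) f.
Proof.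
elim: r => [|x r IHr] /=; first by move=> _ _ _; exists f; rewrite big_nil mul1r.
case/andP=> xr ur reg dvd.
have [|i ir|g fE] := IHr ur.
- by move=> i j a ir jr; apply: reg; rewrite inE ?ir ?jr orbT.
- by apply: dvd; rewrite inE ir orbT.
suff: divides (d x) g.
  by case=> h gE; exists h; rewrite big_cons fE gE mulrA [d x * _]mulrC.
have /dvd : x \in x :: r by rewrite inE eqxx.
rewrite fE; have: {subset r <= r} by [].
elim: {-2}r => [|z s IHs] sr; first by rewrite big_nil mul1r.
have zr : z \in r by apply: sr; rewrite inE eqxx.
have sr' : {subset s <= r} by move=> t ts; apply: sr; rewrite inE ts orbT.
rewrite big_cons -mulrA => dvdzs; apply: (IHs sr').
apply: reg dvdzs; rewrite ?inE ?eqxx ?zr ?orbT //.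
by apply: contraNneq xr => ->.
Qed.

Lemma divides_horner_sub (p : {poly S}) a b : divides (a - b) (p.[a] - p.[b]).
Proof.
have /factor_theorem[q pq]: root (p - p.[b]%:P) b.
  by rewrite /root !hornerE subrr.
exists q.[a]; have /(congr1 (horner^~ a)) := pq.
by rewrite hornerM !hornerE mulrC.
Qed.

(* Newton's interpolation: the pairwise congruences make every divided
   difference land in S. *)
Lemma newton_interpolation (I : eqType) (r : seq I) (y u : I -> S) :
  uniq r ->
  (forall n i j a, n != i -> n != j -> i != j ->
     divides (y n - y i) ((y n - y j) * a) -> divides (y n - y i) a) ->
  (forall i j, divides (y i - y j) (u i - u j)) ->
  exists2 p : {poly S}, (size p <= size r)%N & {in r, forall i, p.[y i] = u i}.
Proof.
move=> + reg cong; elim: r => [|x r IHr] /=.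
  by move=> _; exists 0; rewrite ?size_poly0.
case/andP=> xr /[dup] ur /IHr[p szp pE].
have [|i /= ir|c cE] := @divides_prod _ r (fun i => y x - y i) (u x - p.[y x]) ur.
- move=> i j a ir jr; apply: reg; by apply: contraNneq xr => ->.
- have [c1 c1E] := cong x i; have [c2 c2E] := divides_horner_sub p (y x) (y i).
  by exists (c1 - c2); rewrite mulrBr -c1E -c2E (pE i ir); ring.
exists (p + c *: \prod_(i <- r) ('X - (y i)%:P)).
  rewrite (leq_trans (size_polyD _ _)) // geq_max (leq_trans szp) //.
  by rewrite (leq_trans (size_scale_leq _ _)) // size_prod_XsubC.
move=> i; rewrite inE hornerD hornerZ horner_prod.
under eq_bigr do rewrite hornerXsubC.
case/predU1P=> [->|ir]; first by rewrite mulrC -cE; ring.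
by rewrite (big_rem i) //= subrr mul0r mulr0 addr0 pE.
Qed.

End Divisibility.

Section TwoRowSchur.
Variable S : comNzRingType.
Implicit Types t u : S.

Definition schur2 (a b : nat) t u : S :=
  \sum_(b <= i < a.+1) t ^+ i * u ^+ (a + b - i).

Lemma mul_sub_schur2 a b t u : (b <= a)%N ->
  (t - u) * schur2 a b t u = t ^+ a.+1 * u ^+ b - t ^+ b * u ^+ a.+1.
Proof.
move=> ba.
have -> : t ^+ b * u ^+ a.+1 = t ^+ b * u ^+ (a.+1 + b - b) by rewrite addnK.
pose h i := t ^+ i * u ^+ (a.+1 + b - i).
have -> : t ^+ a.+1 * u ^+ b = h a.+1 by rewrite /h addKn.
rewrite -[t ^+ b * _]/(h b) -telescope_sumr; last exact: leqW.
rewrite mulr_sumr; apply: eq_big_nat => i /andP[bi ia].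
have le_i : (i <= a + b)%N by rewrite -ltnS (leq_trans ia) // ltnS leq_addr.
by rewrite /h !addSn subSS subSn // !exprS; ring.
Qed.

Lemma schur2C a b t u : schur2 a b t u = schur2 a b u t.
Proof.
rewrite /schur2 big_nat_rev; apply: eq_big_nat => i /andP[bi ia].
have ia' : (i <= a + b)%N by rewrite -ltnS (leq_trans ia) // ltnS leq_addr.
by rewrite addnS subSS [(b + a)%N]addnC subKn // mulrC.
Qed.

End TwoRowSchur.

Lemma rmorph_schur2 (S S' : comNzRingType) (f : {rmorphism S -> S'}) a b t u :
  f (schur2 a b t u) = schur2 a b (f t) (f u).
Proof.
by rewrite rmorph_sum; apply: eq_bigr => i _; rewrite rmorphM !rmorphXn.
Qed.

Section LambdaParts.
Variable l : nat.
Implicit Types la mu : Lambda l.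

Lemma part_le la : (part la ord_max <= part la ord0)%N.
Proof. exact: (valP la). Qed.

Lemma Lambda_inj la mu : part la ord0 = part mu ord0 ->
  part la ord_max = part mu ord_max -> la = mu.
Proof.
move=> e0 e1; apply/val_inj/ffunP => i /=.
case: (i =P ord0) => [->|i0]; first exact: val_inj.
have -> : i = ord_max.
  by apply/val_inj; case: i i0 => [[|[|k]] ik] // [] //; apply/val_inj.
exact: val_inj.
Qed.

End LambdaParts.

Section PolynomialSums.
Variables (S : comNzRingType) (N : nat).
Implicit Types t u : S.

Lemma mul_sub_double_sum (a : nat -> nat -> S) t u :
  (forall q, a N q = 0) -> (forall p, a p N = 0) ->
  (t - u) * (\sum_(p < N.+1) \sum_(q < N.+1) a p q * t ^+ p * u ^+ q) =
  \sum_(p < N.+1) \sum_(q < N.+1)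
    ((if (p : nat) is p'.+1 then a p' q else 0) -
     (if (q : nat) is q'.+1 then a p q' else 0)) * t ^+ p * u ^+ q.
Proof.
move=> aN0 a0N.
under [RHS]eq_bigr do under eq_bigr do rewrite -mulrA mulrBl.
under [RHS]eq_bigr do rewrite sumrB.
rewrite sumrB mulrBl; congr (_ - _).
  rewrite [in LHS]big_ord_recr [in RHS]big_ord_recl /=.
  rewrite [X in _ * (_ + X)]big1 => [|q _]; last by rewrite aN0 !mul0r.
  rewrite [X in _ = X + _]big1 => [|q _]; last by rewrite mul0r.
  rewrite addr0 add0r mulr_sumr; apply: eq_bigr => p _.
  by rewrite mulr_sumr; apply: eq_bigr => q _; rewrite /= exprS; ring.
rewrite mulr_sumr; apply: eq_bigr => p _.
rewrite [in LHS]big_ord_recr [in RHS]big_ord_recl /=.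
rewrite a0N !mul0r addr0 add0r mulr_sumr; apply: eq_bigr => q _.
by rewrite /= exprS; ring.
Qed.

Lemma antisym_double_sum (b : nat -> nat -> S) t u :
  (forall p, b p p = 0) -> (forall p q, b p q = - b q p) ->
  \sum_(p < N) \sum_(q < N) b p q * t ^+ p * u ^+ q =
  \sum_(p < N) \sum_(q < N | (q < p)%N) b p q * (t ^+ p * u ^+ q - t ^+ q * u ^+ p).
Proof.
move=> b0 bN.
pose F (p q : 'I_N) := b p q * t ^+ p * u ^+ q.
transitivity (\sum_(p < N) \sum_(q < N | (q < p)%N) F p q +
              \sum_(p < N) \sum_(q < N | (p < q)%N) F p q).
  rewrite -big_split /=; apply: eq_bigr => p _.
  rewrite (bigID (fun q : 'I_N => (q < p)%N)) /=; congr (_ + _).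
  rewrite (bigD1 p) ?ltnn //= {1}/F b0 !mul0r add0r.
  by apply: eq_bigl => q; rewrite -leqNgt andbC [RHS]ltn_neqAle eq_sym.
rewrite [X in _ + X](exchange_big_dep xpredT) //= -big_split /=.
apply: eq_bigr => p _; rewrite -big_split /=; apply: eq_bigr => q _.
by rewrite /F [b q p]bN; ring.
Qed.

Lemma sum_Lambda (F : nat -> nat -> S) :
  \sum_(la : Lambda N.+1) F (part la ord0).+1 (part la ord_max) =
  \sum_(p < N.+1) \sum_(q < N.+1 | (q < p)%N) F p q.
Proof.
rewrite pair_big_dep /=.
pose h (la : Lambda N.+1) : 'I_N.+1 * 'I_N.+1 :=
  (lift ord0 (val la ord0), widen_ord (leqnSn N) (val la ord_max)).
have hP la : ((h la).2 < (h la).1)%N by rewrite /= /bump /= add1n ltnS (valP la).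
have h_inj : injective h.
  move=> la mu eq_h.
  have e0 : (h la).1 = (h mu).1 :> nat by rewrite eq_h.
  have e1 : (h la).2 = (h mu).2 :> nat by rewrite eq_h.
  by apply: Lambda_inj => //; move: e0; rewrite /= /bump /= !add1n => -[].
transitivity (\sum_(x in h @: predT) F x.1 x.2).
  rewrite big_imset /=; last by move=> la mu _ _; apply: h_inj.
  by apply: eq_bigr.
apply: eq_bigl => -[p q] /=; apply/imsetP/idP => [[la _ pqE]|].
  by have := hP la; rewrite -pqE.
case: p q => [[|p] pN] [q qN] //= qp; rewrite ltnS in qp.
have pN' : (p < N)%N by [].
have qN' : (q < N)%N by apply: leq_ltn_trans pN'.
pose f : {ffun 'I_2 -> 'I_N} :=
  [ffun i => if i == ord0 then Ordinal pN' else Ordinal qN'].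
have fP : (f ord_max <= f ord0)%N by rewrite !ffunE.
exists (exist _ f fP : Lambda N.+1) => //.
by congr (_, _); apply/val_inj; rewrite /= !ffunE.
Qed.

End PolynomialSums.

Section PolynomialRoots.
Variables (S : idomainType) (I : finType).

Lemma poly_eq0_inj_roots (D : {pred I}) (y : I -> S) (p : {poly S}) :
  {in D &, injective y} -> {in D, forall i, p.[y i] = 0} ->
  (size p <= #|D|)%N -> p = 0.
Proof.
move=> y_inj py szp; apply: (@roots_geq_poly_eq0 _ p [seq y i | i <- enum D]).
- by apply/allP => _ /mapP[i iD ->]; rewrite /root py ?eqxx // -mem_enum.
- rewrite map_inj_in_uniq ?enum_uniq // => i j; rewrite !mem_enum.
  exact: y_inj.
- by rewrite size_map -cardE.
Qed.

Lemma vandermonde_double_sum_eq0 n (y : 'I_n -> S) (b : 'I_n -> 'I_n -> S) :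
  injective y ->
  (forall i j, \sum_(p < n) \sum_(q < n) b p q * y i ^+ p * y j ^+ q = 0) ->
  forall p q, b p q = 0.
Proof.
move=> y_inj b0 p q.
have coef0 (c : 'I_n -> S) :
    (forall i, \sum_(p < n) c p * y i ^+ p = 0) -> forall p, c p = 0.
  move=> c0 {}p; pose P := \poly_(i < n) (if insub i is Some i' then c i' else 0).
  have PE i : P.[y i] = \sum_(p < n) c p * y i ^+ p.
    by rewrite horner_poly; apply: eq_bigr => r _; rewrite valK.
  have P0 : P = 0.
    apply: (@roots_geq_poly_eq0 _ P [seq y i | i <- enum 'I_n]).
    - by apply/allP => _ /mapP[i _ ->]; rewrite /root PE c0.
    - by rewrite map_inj_uniq ?enum_uniq.
    - by rewrite size_map size_enum_ord size_poly.
  by have := congr1 (fun P : {poly S} => P`_p) P0; rewrite coef_poly ltn_ord valK coef0.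
apply: (coef0 (b p)) => j; move: p; apply: coef0 => i.
rewrite -[RHS](b0 i j); apply: eq_bigr => p _; rewrite mulr_suml.
by apply: eq_bigr => r _; rewrite mulrAC.
Qed.

End PolynomialRoots.

Section SymmetricMatrices.
Variables (S : idomainType) (N : nat) (T : Type).
Local Notation I := 'I_N.+1.
Variables (phi : T -> {rmorphism S -> S}) (k j : T -> I) (c : T -> S).
Variables (y w : I -> S).

(* For h : T encoding the hyperplane x_(k h) = c h * x_(j h) and phi h the
   reduction modulo its equation, M consists of the derivations
   \sum_i v i * d_i that are tangent to all the hyperplanes. *)
Definition tangent (v : I -> S) :=
  forall h, phi h (v (k h) - c h * v (j h)) = 0.

Hypothesis y_inj : injective y.
Hypothesis w_neq0 : forall i, w i != 0.
Hypothesis tangent_poly : forall v, tangent v ->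
  exists2 p : {poly S}, (size p <= N.+1)%N & forall i, v i = w i * p.[y i].
Hypothesis poly_tangent : forall p : {poly S}, tangent (fun i => w i * p.[y i]).
Hypothesis phi_y : forall h, {in [pred i | i != k h] &, injective (phi h \o y)}.
Hypothesis phi_w : forall h i, i != k h -> phi h (w i) != 0.

Lemma tangent_ext v v' : v =1 v' -> tangent v -> tangent v'.
Proof. by move=> vv' tv h; rewrite -!vv'. Qed.

Lemma tangentD v v' : tangent v -> tangent v' -> tangent (fun i => v i + v' i).
Proof.
move=> tv tv' h; rewrite mulrDr opprD addrACA rmorphD.
by rewrite tv tv' addr0.
Qed.

Lemma tangentZ a v : tangent v -> tangent (fun i => a * v i).
Proof. by move=> tv h; rewrite mulrCA -mulrBr rmorphM tv mulr0. Qed.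

Lemma tangent_sum (J : finType) (v : J -> I -> S) :
  (forall x, tangent (v x)) -> tangent (fun i => \sum_x v x i).
Proof.
move=> tv h; rewrite mulr_sumr -sumrB raddf_sum big1 // => x _; exact: tv.
Qed.

Lemma tangent_coef (r : I -> {poly S}) :
  (forall i, size (r i) <= N)%N ->
  (forall i, tangent (fun x => w i * (r x).[y i])) ->
  forall p, tangent (fun x => (r x)`_p).
Proof.
move=> szr tr p h.
pose d := r (k h) - c h *: r (j h).
have -> : (r (k h))`_p - c h * (r (j h))`_p = d`_p by rewrite coefB coefZ.
suff d0 : map_poly (phi h) d = 0 by rewrite -coef_map d0 coef0.
apply: (@poly_eq0_inj_roots _ _ [pred i | i != k h] (phi h \o y)) => //.
- exact: phi_y.
- move=> i ik; rewrite /= horner_map; apply: (mulfI (phi_w ik)).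
  rewrite mulr0 -rmorphM -[RHS](tr i h) /d !hornerE; congr (phi h _) => /=; ring.
- have -> : #|[pred i | i != k h]| = N.
    by have := cardC1 (k h); rewrite card_ord.
  rewrite (leq_trans (size_poly _ _)) // (leq_trans (size_polyD _ _)) //.
  rewrite geq_max szr size_polyN (leq_trans (size_scale_leq _ _)) //.
Qed.

Definition others (i : I) : {poly S} := \prod_(x | x != i) ('X - (y x)%:P).

Lemma horner_others i z : (others i).[z] = \prod_(x | x != i) (z - y x).
Proof. by rewrite horner_prod; apply: eq_bigr => x _; rewrite hornerXsubC. Qed.

Lemma horner_others_neq i x : x != i -> (others i).[y x] = 0.
Proof. by move=> xi; rewrite horner_others (bigD1 x) //= subrr mul0r. Qed.

Lemma size_others i : size (others i) = N.+1.
Proof.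
have -> : others i = \prod_(x <- enum (predC1 i)) ('X - (y x)%:P).
  by rewrite big_enum.
by rewrite size_prod_XsubC -cardE cardC1 card_ord.
Qed.

Lemma others_monic i : others i \is monic.
Proof. exact: monic_prod_XsubC. Qed.

Lemma size_sub_others (p : {poly S}) i :
  (size p <= N.+1)%N -> (size (p - p`_N *: others i)%R <= N)%N.
Proof.
move=> szp; apply/leq_sizeP => r; rewrite leq_eqVlt => /predU1P[<-|Nr].
  rewrite coefB coefZ; have /monicP := others_monic i.
  by rewrite lead_coefE size_others => ->; rewrite mulr1 subrr.
rewrite coefB coefZ nth_default ?(leq_trans szp) //.
by rewrite [X in _ * X]nth_default ?size_others // mulr0 subrr.
Qed.

Definition schur_form (a b : nat) (i x : I) : S :=
  w i * w x * schur2 a b (y i) (y x).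

Lemma schur_form_tangent a b x : tangent (schur_form a b ^~ x).
Proof.
have := @poly_tangent (w x *: \sum_(b <= i < a.+1) y x ^+ (a + b - i) *: 'X^i).
apply: tangent_ext => i; rewrite hornerZ horner_sum /schur_form /schur2 mulrA.
by congr (_ * _); apply: eq_bigr => r _; rewrite hornerZ hornerXn mulrC.
Qed.

Definition diag_form (e : S) (i x : I) : S :=
  if i == x then e * (w i * (others i).[y i]) else 0.

Lemma diag_form_tangent e x : tangent (diag_form e ^~ x).
Proof.
have := @poly_tangent (e *: others x).
apply: tangent_ext => i; rewrite hornerZ /diag_form.
case: eqVneq => [->|ix]; first by rewrite mulrCA.
by rewrite horner_others_neq // !mulr0.
Qed.

(* Only the off-diagonal entries are matched: the matrix [w i * (r x).[y i]]
   below differs from g by multiples of the forms [diag_form]. *)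
Lemma symmetric_tangent_offdiag (g : I -> I -> S) :
  (forall i x, g i x = g x i) -> (forall x, tangent (g ^~ x)) ->
  exists cf : Lambda N.+1 -> S, forall i x, i != x ->
    g i x = \sum_la cf la * schur_form (part la ord0) (part la ord_max) i x.
Proof.
move=> gC tg.
have /fin_all_exists2[p szp pE] x := tangent_poly (tg x).
pose r x := p x - (p x)`_N *: others x.
have szr x : (size (r x) <= N)%N by apply: size_sub_others.
have rE i x : i != x -> w i * (r x).[y i] = g i x.
  by move=> ix; rewrite /r !hornerE horner_others_neq // mulr0 subr0 pE.
have rC i x : w i * (r x).[y i] = w x * (r i).[y x].
  by case: (eqVneq i x) => [->//|ix]; rewrite !rE // eq_sym.
have tr i : tangent (fun x => w i * (r x).[y i]).
  apply: tangent_ext (poly_tangent (r i)) => x; exact: rC.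
have /fin_all_exists2[A szA AE] (s : I) := tangent_poly (tangent_coef szr tr s).
pose a (s q : I) := (A s)`_q.
have raE i x : w i * (r x).[y i] =
    w i * w x * \sum_(s < N.+1) \sum_(q < N.+1) a s q * y i ^+ s * y x ^+ q.
  rewrite -mulrA; congr (_ * _); rewrite (@horner_coef_wide _ N.+1); last first.
    exact: leqW.
  rewrite mulr_sumr; apply: eq_bigr => s _; rewrite AE -mulrA; congr (_ * _).
  rewrite (horner_coef_wide _ (szA s)) mulr_suml; apply: eq_bigr => q _.
  by rewrite /a; ring.
have aC s q : a s q = a q s.
  apply/eqP; rewrite -subr_eq0; apply/eqP; move: s q.
  apply: (vandermonde_double_sum_eq0 y_inj) => i x.
  have ww : w i * w x != 0 by rewrite mulf_neq0.
  apply: (mulfI ww); rewrite mulr0.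
  under eq_bigr do under eq_bigr do rewrite -mulrA mulrBl.
  under eq_bigr do rewrite sumrB.
  rewrite sumrB mulrBr; apply/eqP; rewrite subr_eq0; apply/eqP.
  under eq_bigr do under eq_bigr do rewrite mulrA.
  rewrite -raE rC raE [w x * w i]mulrC; congr (_ * _).
  rewrite exchange_big; apply: eq_bigr => s _; apply: eq_bigr => q _ /=; ring.
have aN q : a ord_max q = 0.
  suff AN0 : A ord_max = 0 by rewrite /a AN0 coef0.
  apply: (@poly_eq0_inj_roots _ _ predT y) => //.
  - by move=> i x _ _; apply: y_inj.
  - move=> x _; apply: (mulfI (w_neq0 x)); rewrite mulr0 -AE /=.
    exact: nth_default.
  - by rewrite cardT size_enum_ord.
pose a' (s q : nat) := if (s < N)%N && (q < N)%N then a (inord s) (inord q) else 0.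
have a'E (s q : I) : a' s q = a s q.
  rewrite /a' !inord_val; case: ltnP => [sN|Ns] /=; last first.
    suff -> : s = ord_max by rewrite aN.
    by apply/val_inj/eqP; rewrite eqn_leq Ns -ltnS ltn_ord.
  case: ltnP => // Nq; suff -> : q = ord_max by rewrite aC aN.
  by apply/val_inj/eqP; rewrite eqn_leq Nq -ltnS ltn_ord.
pose b (s q : nat) := (if s is s'.+1 then a' s' q else 0) -
                      (if q is q'.+1 then a' s q' else 0).
have a'C s q : a' s q = a' q s by rewrite /a' andbC aC.
have bN s q : b s q = - b q s.
  rewrite /b opprB; case: s q => [|s] [|q];
    by rewrite // ?(a'C _ q) ?(a'C _ q.+1) // a'C.
have b0 s : b s s = 0 by rewrite /b; case: s => [|s]; rewrite ?subrr // a'C subrr.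
exists (fun la => b (part la ord0).+1 (part la ord_max)) => i x ix.
have yix : y i - y x != 0 by rewrite subr_eq0; apply: contra_neq ix => /y_inj.
rewrite -rE // raE.
apply: (mulfI yix); rewrite mulrCA.
under eq_bigr do under eq_bigr do rewrite -a'E.
rewrite mul_sub_double_sum; first last.
- by move=> s; rewrite /a' ltnn andbF.
- by move=> s; rewrite /a' ltnn.
rewrite (antisym_double_sum N.+1 (y i) (y x) b0 bN).
rewrite -(sum_Lambda N (fun s q =>
  b s q * (y i ^+ s * y x ^+ q - y i ^+ q * y x ^+ s))).
rewrite !mulr_sumr; apply: eq_bigr => la _.
rewrite -(mul_sub_schur2 _ _ (valP la)) /schur_form; ring.
Qed.

Lemma symmetric_tangent_gen (g : I -> I -> S) :
  (forall i x, g i x = g x i) -> (forall x, tangent (g ^~ x)) ->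
  exists (cf : Lambda N.+1 -> S) (e : I -> S), forall i x,
    g i x = \sum_la cf la * schur_form (part la ord0) (part la ord_max) i x +
            diag_form (e i) i x.
Proof.
move=> gC tg; have [cf cfE] := symmetric_tangent_offdiag gC tg.
exists cf.
pose d i x := g i x -
  \sum_la cf la * schur_form (part la ord0) (part la ord_max) i x.
have d0 i x : i != x -> d i x = 0 by move=> /cfE; rewrite /d => ->; rewrite subrr.
have td x : tangent (d ^~ x).
  apply: tangentD => //; apply: (@tangent_ext (fun i => -1 *
    \sum_la cf la * schur_form (part la ord0) (part la ord_max) i x)).
    by move=> i; rewrite mulN1r.
  apply: tangentZ; apply: tangent_sum => la; apply: tangentZ.
  exact: schur_form_tangent.
have /fin_all_exists2[p szp pE] x := tangent_poly (td x).
exists (fun x => (p x)`_N) => i x.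
suff <- : d i x = diag_form (p i)`_N i x by rewrite /d addrC subrK.
rewrite /diag_form; case: eqVneq => [<-|/d0//]; rewrite pE mulrCA.
suff {1}-> : p i = (p i)`_N *: others i by rewrite hornerZ.
apply/eqP; rewrite -subr_eq0; apply/eqP.
apply: (@poly_eq0_inj_roots _ _ (predC1 i) y).
- by move=> z t _ _; apply: y_inj.
- move=> z; rewrite inE => zi; rewrite hornerD hornerN hornerZ.
  rewrite horner_others_neq // mulr0 subr0.
  by apply: (mulfI (w_neq0 z)); rewrite -pE d0 ?mulr0.
- by rewrite cardC1 card_ord size_sub_others.
Qed.

Lemma symmetric_tangent_free (cf : Lambda N.+1 -> S) (e : I -> S) :
  (forall i x,
    \sum_la cf la * schur_form (part la ord0) (part la ord_max) i x +
    diag_form (e i) i x = 0) ->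
  (forall la, cf la = 0) /\ (forall i, e i = 0).
Proof.
move=> comb0.
have cf0 la : cf la = 0.
  pose cc (s q : I) := \sum_(mu : Lambda N.+1)
    if ((part mu ord0).+1 == s) && (part mu ord_max == q) then cf mu else 0.
  have ccE t u : \sum_s \sum_q cc s q * t ^+ s * u ^+ q =
      \sum_(mu : Lambda N.+1)
        cf mu * t ^+ (part mu ord0).+1 * u ^+ (part mu ord_max).
    under eq_bigr do under eq_bigr do rewrite !mulr_suml.
    under eq_bigr do rewrite exchange_big.
    rewrite exchange_big; apply: eq_bigr => mu _ /=.
    rewrite (bigD1 (lift ord0 (val mu ord0))) //=.
    rewrite (bigD1 (widen_ord (leqnSn N) (val mu ord_max))) //=.
    rewrite /bump /= add1n !eqxx /= big1 ?addr0 => [|q]; last first.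
      rewrite -val_eqE /= eq_sym => /negPf ->.
      by rewrite !mul0r.
    rewrite big1 ?addr0 // => s.
    rewrite -val_eqE /= /bump /= add1n eq_sym => /negPf ->.
    by rewrite big1 // => q _; rewrite !mul0r.
  have b0 : forall s q, cc s q - cc q s = 0.
    apply: (vandermonde_double_sum_eq0 y_inj) => i x.
    under eq_bigr do under eq_bigr do rewrite !mulrBl.
    under eq_bigr do rewrite sumrB.
    rewrite sumrB ccE [X in _ - X]exchange_big /=.
    under [X in _ - X]eq_bigr do under eq_bigr do rewrite mulrAC.
    rewrite ccE -sumrB.
    have : (y i - y x) * (\sum_la
        cf la * schur_form (part la ord0) (part la ord_max) i x) = 0.
      case: (eqVneq i x) => [->|ix]; first by rewrite subrr mul0r.
      have := comb0 i x; rewrite /diag_form (negPf ix) addr0 => ->.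
      by rewrite mulr0.
    have ww : w i * w x != 0 by rewrite mulf_neq0.
    move=> E; apply: (mulfI ww); rewrite mulr0 -[RHS]E.
    rewrite !mulr_sumr; apply: eq_bigr => mu _.
    transitivity (cf mu * (w i * w x) * ((y i - y x) *
      schur2 (@part N.+1 mu ord0) (@part N.+1 mu ord_max) (y i) (y x))).
      rewrite mul_sub_schur2; last exact: (@part_le N.+1 mu).
      by ring.
    by rewrite /schur_form; ring.
  have := b0 (lift ord0 (val la ord0)) (widen_ord (leqnSn N) (val la ord_max)).
  rewrite /cc [X in _ - X]big1 ?subr0 => [|mu _]; last first.
    case: ifP => // /andP[/eqP e0 /eqP e1].
    have := @part_le N.+1 mu; rewrite leqNgt; case/negP.
    move: e0 e1; rewrite /= /bump /= add1n -[X in _ = X -> _]/(@part N.+1 la ord_max).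
    move=> e0 e1; rewrite e1 ltnW // ltnS.
    by rewrite (leq_trans _ (@part_le N.+1 la)) // -e0.
  rewrite (bigD1 la) //= /bump /= add1n !eqxx /= big1 ?addr0 // => mu mula.
  case: ifP => // /andP[/eqP[e0] /eqP e1]; case/negP: mula.
  by apply/eqP; apply: (@Lambda_inj N.+1).
split=> // i; have := comb0 i i; rewrite big1 => [|la _]; last first.
  by rewrite cf0 mul0r.
rewrite add0r /diag_form eqxx => /eqP; rewrite mulf_eq0 => /orP[/eqP//|].
rewrite mulf_eq0 (negPf (w_neq0 i)) horner_others prodf_seq_eq0 /=.
case/hasP => x _ /andP[xi]; rewrite subr_eq0 => /eqP /y_inj ix.
by rewrite ix eqxx in xi.
Qed.

End SymmetricMatrices.

Section HomogeneousComponents.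
Variables (n : nat) (R : nzRingType).
Implicit Types c p : {mpoly R[n]}.

Lemma pihomogM_homog c p d e : p \is d.-homog ->
  pihomog mdeg e (c * p) = if (d <= e)%N then pihomog mdeg (e - d) c * p else 0.
Proof.
move=> hp; pose K := maxn (mmeasure mdeg c) e.+1.
rewrite {1}(@pihomog_partitionE _ _ mdeg K c) ?leq_maxl //.
rewrite mulr_suml raddf_sum /=.
have hom k : pihomog mdeg k c * p \is (k + d).-homog.
  by apply: dhomogM => //; apply: pihomogP.
case: leqP => [de|ed]; last first.
  apply: big1 => k _; apply: pihomog_ne0 (hom k).
  by rewrite gtn_eqF // (leq_trans ed) ?leq_addl.
have lt_K : (e - d < K)%N by rewrite (leq_ltn_trans (leq_subr _ _)) // leq_maxr.
rewrite (bigD1 (Ordinal lt_K)) //= big1 ?addr0 => [|k kE]; last first.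
  apply: pihomog_ne0 (hom k); apply: contraNneq kE => kE.
  by apply/eqP/val_inj; rewrite /= -kE addnK.
by rewrite pihomog_dE //; have := hom (e - d)%N; rewrite subnK.
Qed.

Lemma mcoeff0_homog p d : p \is d.-homog -> p@_0%MM != 0 -> d = 0%N.
Proof.
move=> /dhomog_nemf_coeff hp; apply: contraNeq => d0.
by rewrite hp // mf0 eq_sym.
Qed.

End HomogeneousComponents.

Section FreeFamilies.
Variables (A : comNzRingType) (V : lmodType A).

Definition free_family (I : finType) (b : I -> V) :=
  forall c : I -> A, \sum_i c i *: b i = 0 -> forall i, c i = 0.

Lemma free_family_neq0 (I : finType) (b : I -> V) i : free_family b -> b i <> 0.
Proof.
move=> free bi0.
have /free/(_ i)/eqP : \sum_j (j == i)%:R *: b j = 0.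
  by rewrite big1 // => j _; case: eqP => [->|_]; rewrite ?bi0 ?scaler0 ?scale0r.
by rewrite eqxx oner_eq0.
Qed.

Lemma free_family_eq (I : finType) (b : I -> V) (c c' : I -> A) :
  free_family b -> \sum_i c i *: b i = \sum_i c' i *: b i -> c =1 c'.
Proof.
move=> free cc' i; apply/eqP; rewrite -subr_eq0; apply/eqP; move: i; apply: free.
by under eq_bigr do rewrite scalerBl; rewrite sumrB cc' subrr.
Qed.

Lemma free_family_change (I J : finType) (b : I -> V) (b' : J -> V)
    (c : J -> I -> A) (e : I -> J -> A) :
  free_family b' -> (forall j, b' j = \sum_i c j i *: b i) ->
  (forall i, b i = \sum_j e i j *: b' j) ->
  forall j k, \sum_i c j i * e i k = (j == k)%:R.
Proof.
move=> free cE eE j; apply: (free_family_eq free).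
rewrite [RHS](bigD1 j) //= eqxx scale1r [X in _ = _ + X]big1 ?addr0; last first.
  by move=> k kj; rewrite eq_sym (negPf kj) scale0r.
rewrite [RHS]cE; under eq_bigr do rewrite scaler_suml.
rewrite exchange_big; apply: eq_bigr => i _ /=; rewrite [in RHS]eE scaler_sumr.
by apply: eq_bigr => k _; rewrite scalerA.
Qed.

Lemma free_family_reindex (I : finType) (b : I -> V) :
  free_family b -> free_family (fun i : 'I_#|I| => b (enum_val i)).
Proof.
move=> free c sum0 i; rewrite -[i]enum_valK; move: (enum_val i) => {}i.
apply: (free (c \o enum_rank)); rewrite -[RHS]sum0.
rewrite (reindex_onto enum_val enum_rank) /=; last by move=> ? _; rewrite enum_rankK.
by apply: eq_big => [j|j _]; rewrite ?enum_valK ?eqxx.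
Qed.

Lemma sum_enum_val (I : finType) (F : I -> V) :
  \sum_i F i = \sum_(i < #|I|) F (enum_val i).
Proof.
rewrite (reindex_onto enum_val enum_rank) /=; last by move=> i _; rewrite enum_rankK.
by apply: eq_bigl => i; rewrite enum_valK eqxx.
Qed.

End FreeFamilies.

Section Bases.
Variables (R : realType) (l m : nat).
Local Notation S := {mpoly R[l]}.
Local Notation dop := (dop R l m).
Implicit Types M : set dop.

Lemma dopP (th th' : dop) : (forall a, th a = th' a) -> th = th'.
Proof. by move=> eq_th; apply: (proj1 (ffunP th th')). Qed.

Lemma dop_sumE n (c : 'I_n -> S) (b : 'I_n -> dop) a :
  (\sum_i c i *: b i) a = \sum_i c i * b i a.
Proof. by rewrite sum_ffunE; apply: eq_bigr => i _; rewrite ffunE. Qed.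

(* Comparing components of degree d', the coefficients of a homogeneous
   element in a homogeneous basis are homogeneous. *)
Lemma homog_coord_mcoeff0 n M (b : 'I_n -> dop) d (th : dop) d' (c : 'I_n -> S) j :
  is_homog_basis M b d -> (forall a, (th a : S) \is d'.-homog) ->
  th = \sum_i c i *: b i -> (c j)@_0%MM != 0 -> d' = d j.
Proof.
case=> -[_ _ free] hb hth thE.
pose c' i : S := if (d i <= d')%N then pihomog mdeg (d' - d i) (c i) else 0.
have thE' : th = \sum_i c' i *: b i.
  apply: dopP => a; rewrite [RHS]dop_sumE -[LHS](pihomog_dE (hth a)).
  have -> : th a = \sum_i c i * b i a by rewrite -dop_sumE -thE.
  rewrite raddf_sum; apply: eq_bigr => i _.
  rewrite [LHS](pihomogM_homog _ _ ((hb i).2 a)) /c'.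
  by case: ifP => // _; rewrite mul0r.
have cE : c j = c' j by apply: (free_family_eq free); apply: etrans (esym thE) thE'.
rewrite cE /c'; case: leqP => [le_d|_]; last by rewrite mcoeff0 eqxx.
move=> /(mcoeff0_homog (pihomogP _ _ _)) /eqP; rewrite subn_eq0 => le_d'.
by apply/eqP; rewrite eqn_leq le_d'.
Qed.

Lemma basis_change_mx n n' M (b : 'I_n -> dop) (b' : 'I_n' -> dop)
    (C : 'I_n' -> 'I_n -> S) (E : 'I_n -> 'I_n' -> S) :
  is_basis M b' ->
  (forall i, b' i = \sum_j C i j *: b j) ->
  (forall j, b j = \sum_i E j i *: b' i) ->
  (\matrix_(i, j) (C i j)@_0%MM) *m (\matrix_(j, i) (E j i)@_0%MM) = 1%:M.
Proof.
case=> _ _ free CE EE; apply/matrixP => i k; rewrite !mxE.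
under eq_bigr do rewrite !mxE -rmorphM.
by rewrite -raddf_sum /= (free_family_change free CE EE) rmorph_nat.
Qed.

(* The constant terms of the coefficients form an invertible matrix, and a
   nonzero term in the expansion of its determinant matches the degrees. *)
Lemma homog_basis_degrees n n' M (b : 'I_n -> dop) d (b' : 'I_n' -> dop) d' :
  is_homog_basis M b d -> is_homog_basis M b' d' ->
  perm_eq (codom d') (codom d).
Proof.
move=> hb hb'; have [[Mb gen _] homb] := hb; have [[Mb' gen' _] homb'] := hb'.
have /fin_all_exists[C CE] i := gen _ (Mb' i).
have /fin_all_exists[E EE] j := gen' _ (Mb j).
have CE1 := basis_change_mx hb'.1 CE EE.
have EC1 := basis_change_mx hb.1 EE CE.
have nn' : n' = n by apply/eqP; rewrite eqn_leq (mulmx1_min CE1) (mulmx1_min EC1).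
subst n'.
set A := \matrix_(i, j) _ in CE1.
have detA : \det A != 0.
  by have [+ _] := mulmx1_unit CE1; rewrite unitmxE unitfE.
have [s sP] : exists s : 'S_n, forall i, A i (s i) != 0.
  suff /existsP[s /forallP sP] : [exists s : 'S_n, [forall i, A i (s i) != 0]].
    by exists s.
  apply: contra_neqT detA => none; rewrite /determinant big1 // => s _.
  move: none; rewrite negb_exists => /forallP/(_ s).
  rewrite negb_forall => /existsP[i]; rewrite negbK => /eqP Ai.
  by rewrite (bigD1 i) //= Ai mul0r mulr0.
have d'E : codom d' = [seq d (s i) | i : 'I_n].
  apply: eq_codom => i; apply: (homog_coord_mcoeff0 hb (homb' i).2 (CE i)).
  by have := sP i; rewrite mxE.
rewrite d'E /codom /image_mem (map_comp d s) perm_map //.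
apply: uniq_perm; rewrite ?enum_uniq //.
  by rewrite map_inj_uniq ?enum_uniq //; apply: perm_inj.
move=> i; rewrite mem_enum; apply/mapP; exists ((s^-1)%g i); rewrite ?mem_enum //.
by rewrite permKV.
Qed.

Lemma is_exp_basis (I : finType) M (b : I -> dop) (d : I -> nat) E :
  is_basis M b -> (forall i a, (b i a : S) \is (d i).-homog) ->
  perm_eq (codom d) E -> is_exp M E.
Proof.
move=> basis_b hom_b dE; have [Mb gen free] := basis_b.
pose b' (i : 'I_#|I|) := b (enum_val i); pose d' (i : 'I_#|I|) := d (enum_val i).
have hb' : is_homog_basis M b' d'.
  split; last first.
    by move=> i; split; [exact: (free_family_neq0 free) | exact: hom_b].
  split=> [i|th /gen[c ->]|]; [exact: Mb | | exact: free_family_reindex].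
  by exists (c \o enum_val); rewrite sum_enum_val.
have codom_d' : perm_eq (codom d') (codom d).
  rewrite /codom /image_mem (map_comp d enum_val) perm_map //.
  apply: uniq_perm; rewrite ?enum_uniq //.
    by rewrite map_inj_uniq ?enum_uniq //; apply: enum_val_inj.
  move=> i; rewrite mem_enum; apply/mapP; exists (enum_rank i); rewrite ?mem_enum //.
  by rewrite enum_rankK.
split=> [|n c e hc]; first by exists #|I|, b', d'.
by rewrite (perm_trans (homog_basis_degrees hb' hc)) // (perm_trans codom_d').
Qed.

End Bases.

Section Hyperplanes.
Variables (R : idomainType) (l : nat).
Local Notation S := {mpoly R[l]}.

(* The triple (k, j, c) stands for the hyperplane x_k = c x_j. Coordinate
   hyperplanes are the triples (k, k, 0). *)
Definition hyperplane := ('I_l * 'I_l * R)%type.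
Implicit Types h : hyperplane.

Definition hform h : S := 'X_h.1.1 - h.2%:MP * 'X_h.1.2.

Definition normal_hyperplane h :=
  if h.1.1 == h.1.2 then h.2 == 0 else (h.1.1 < h.1.2)%N && (h.2 != 0).

Definition proper_hyperplane h := (h.1.1 != h.1.2) || (h.2 == 0).

Lemma normal_proper h : normal_hyperplane h -> proper_hyperplane h.
Proof. by rewrite /normal_hyperplane /proper_hyperplane; case: eqP. Qed.

Definition hsubst h : {rmorphism S -> S} :=
  comp_mpoly [tuple if i == h.1.1 then h.2%:MP * 'X_h.1.2 else 'X_i | i < l].

Arguments hsubst : simpl never.

Lemma hsubstC h c : hsubst h c%:MP = c%:MP.
Proof. exact: comp_mpolyC. Qed.

Lemma hsubstX h i :
  hsubst h 'X_i = if i == h.1.1 then h.2%:MP * 'X_h.1.2 else 'X_i.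
Proof. by rewrite /hsubst /= comp_mpolyXU -tnth_nth tnth_mktuple. Qed.

Lemma hsubst_hformE h h' :
  hsubst h (hform h') = hsubst h 'X_h'.1.1 - h'.2%:MP * hsubst h 'X_h'.1.2.
Proof. by rewrite /hform rmorphB rmorphM hsubstC. Qed.

Lemma hsubst_hform h : proper_hyperplane h -> hsubst h (hform h) = 0.
Proof.
rewrite /proper_hyperplane hsubst_hformE !hsubstX eqxx.
case: eqP => [_ /eqP ->|kj _]; first by rewrite mpolyC0 !mul0r subrr.
by case: eqP => [jk|_]; [case: kj | rewrite subrr].
Qed.

Lemma divides_hsubst h f : divides (hform h) (f - hsubst h f).
Proof.
have dvd_sum (J : Type) (r : seq J) (a b : J -> S) :
    (forall i, divides (hform h) (a i - b i)) ->
    divides (hform h) (\sum_(i <- r) a i - \sum_(i <- r) b i).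
  move=> dvd; elim: r => [|x r [c cE]]; first by exists 0; rewrite !big_nil mulr0 subrr.
  have [c' c'E] := dvd x; exists (c' + c).
  by rewrite !big_cons mulrDr -cE -c'E; ring.
have dvd_mul a a' b b' : divides (hform h) (a - a') -> divides (hform h) (b - b') ->
    divides (hform h) (a * b - a' * b').
  move=> [c cE] [c' c'E]; exists (c * b + a' * c').
  by rewrite mulrDr mulrA -cE mulrCA -c'E; ring.
have dvdX i n : divides (hform h) ('X_i ^+ n - hsubst h 'X_i ^+ n).
  elim: n => [|n IHn]; first by exists 0; rewrite mulr0 subrr.
  rewrite !exprS; apply: dvd_mul => //; rewrite hsubstX; case: eqP => [->|_].
    by exists 1; rewrite mulr1.
  by exists 0; rewrite mulr0 subrr.
have -> : hsubst h f = \sum_(m <- msupp f) hsubst h (f@_m *: 'X_[m]).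
  by rewrite {1}(mpolyE f) (raddf_sum (hsubst h)).
rewrite [X in X - _](mpolyE f); apply: dvd_sum => m.
rewrite -!mul_mpolyC rmorphM; apply: (dvd_mul).
  by rewrite hsubstC; exists 0; rewrite mulr0 subrr.
rewrite mpolyXE_id rmorph_prod /=; under [X in _ - X]eq_bigr do rewrite rmorphXn.
apply: (big_rec2 (fun a b => divides (hform h) (a - b))) => [|i a b _ dvd].
  by exists 0; rewrite mulr0 subrr.
by apply: dvd_mul.
Qed.

Lemma hsubst_eq0P h f : proper_hyperplane h ->
  hsubst h f = 0 <-> divides (hform h) f.
Proof.
move=> nh; split=> [f0|[c ->]]; last by rewrite rmorphM hsubst_hform // mul0r.
by have := divides_hsubst h f; rewrite f0 subr0.
Qed.

Lemma hsubst_hform_neq0 h h' : normal_hyperplane h -> normal_hyperplane h' ->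
  h != h' -> hsubst h (hform h') != 0.
Proof.
move=> nh nh'; apply: contra_neq => /eqP; rewrite hsubst_hformE !hsubstX => /eqP.
move: nh nh'; rewrite /normal_hyperplane; case: h h' => [[k j] c] [[k' j'] c'] /=.
move=> nh nh' phi0.
have coefs x : (if k' == k then c * (j == x)%:R else (k' == x)%:R) =
    c' * (if j' == k then c * (j == x)%:R else (j' == x)%:R).
  have mcoeff_if (b : bool) (p q : S) m :
      (if b then p else q)@_m = if b then p@_m else q@_m.
    by case: b.
  move: phi0 => /(congr1 (mcoeff U_(x))) /eqP.
  rewrite mcoeff0 mcoeffB mcoeffCM !mcoeff_if !mcoeffCM !mcoeffXU.
  by rewrite subr_eq0 => /eqP.
case: (eqVneq k' k) coefs => [kk|kk] coefs.
  subst k'; case: (eqVneq c' 0) => [c0|c'0].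
    have := coefs j; rewrite c0 mul0r eqxx mulr1 => cE.
    move: nh nh'; rewrite cE c0 eqxx !andbF.
    by case: eqP => // <-; case: eqP => // <-.
  move: nh'; rewrite (negPf c'0); case: eqP => // kj' /andP[_ _].
  have := coefs j'; have /eqP/negPf-> : j' <> k by move=> E; case: kj'.
  rewrite eqxx mulr1; case: eqP => [->|_]; first by rewrite mulr1 => ->.
  by rewrite mulr0 => E; rewrite -E eqxx in c'0.
have := coefs k'; rewrite eqxx; case: (eqVneq j' k) => [j'k|_].
  subst j'; case: eqP => [E|_]; last by rewrite !mulr0 => /eqP; rewrite oner_eq0.
  subst k'; move: nh nh'; rewrite (negPf kk) eq_sym (negPf kk).
  by move=> /andP[kj _] /andP[jk _]; rewrite ltnNge ltnW in kj.
move: nh'; rewrite eq_sym; case: eqP => [_ /eqP -> |_ _].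
  by rewrite mul0r => /eqP; rewrite oner_eq0.
by rewrite mulr0 => /eqP; rewrite oner_eq0.
Qed.

End Hyperplanes.

Section SecondOrder.
Variables (R : idomainType) (l : nat).
Local Notation S := {mpoly R[l]}.
Variable g : 'I_l -> 'I_l -> S.

Definition order2 (f : S) : S := \sum_i \sum_j g i j * f^`M(i)^`M(j).

Definition column_der j (f : S) : S := \sum_i g i j * f^`M(i).

Lemma column_derM j p q :
  column_der j (p * q) = column_der j p * q + p * column_der j q.
Proof.
rewrite /column_der mulr_suml mulr_sumr -big_split /=; apply: eq_bigr => i _.
by rewrite mderivM; ring.
Qed.

Lemma column_der_hform j h :
  column_der j (hform h) = g h.1.1 j - h.2%:MP * g h.1.2 j.
Proof.
have derX k i : ('X_k : S)^`M(i) = (k == i)%:R.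
  rewrite mderivX mnm1E; case: eqP => [->|_]; last by rewrite scale0r.
  by rewrite scale1r -{1}[U_(i)%MM]add0m addmK mpolyX0.
rewrite /column_der /hform.
under eq_bigr do rewrite mderivB mderiv_mulC !derX mulrBr.
rewrite sumrB; under [X in _ - X]eq_bigr do rewrite mulrCA.
rewrite -mulr_sumr; have sumX k : \sum_i g i j * (k == i)%:R = g k j.
  rewrite (bigD1 k) //= eqxx mulr1 big1 ?addr0 // => i.
  by rewrite eq_sym => /negPf ->; rewrite mulr0.
by rewrite !sumX.
Qed.

Lemma order2_hform h : order2 (hform h) = 0.
Proof.
have derX k i j : ('X_k : S)^`M(i)^`M(j) = 0.
  rewrite mderivX mnm1E; case: eqP => [->|_]; last by rewrite scale0r mderiv0.
  by rewrite scale1r -{1}[U_(i)%MM]add0m addmK mpolyX0 -mpolyC1 mderivC.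
rewrite /order2 big1 // => i _; rewrite big1 // => j _.
by rewrite mderivB mderiv_mulC mderivB mderiv_mulC !derX mulr0 subrr mulr0.
Qed.

Hypothesis gC : forall i j, g i j = g j i.

Lemma order2M p q : order2 (p * q) =
  order2 p * q + (\sum_j column_der j p * q^`M(j)) *+ 2 + p * order2 q.
Proof.
have -> : (\sum_j column_der j p * q^`M(j)) *+ 2 =
    \sum_i \sum_j g i j * (p^`M(i) * q^`M(j) + p^`M(j) * q^`M(i)).
  under [RHS]eq_bigr do under eq_bigr do rewrite mulrDr.
  under [RHS]eq_bigr do rewrite big_split /=.
  rewrite big_split mulr2n /=; congr (_ + _).
    rewrite exchange_big; apply: eq_bigr => j _; rewrite mulr_suml.
    by apply: eq_bigr => i _; rewrite mulrA.
  apply: eq_bigr => i _; rewrite mulr_suml.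
  by apply: eq_bigr => j _; rewrite gC mulrA.
rewrite /order2 mulr_suml mulr_sumr -!big_split; apply: eq_bigr => i _ /=.
rewrite mulr_suml mulr_sumr -!big_split; apply: eq_bigr => j _ /=.
by rewrite mderivM mderivD !mderivM; ring.
Qed.

Variables (hs : seq (hyperplane R l)) (Q : S).
Hypothesis hs_uniq : uniq hs.
Hypothesis hs_normal : {in hs, forall h, normal_hyperplane h}.
Let hs_proper : {in hs, forall h, proper_hyperplane h}.
Proof. by move=> h /hs_normal /normal_proper. Qed.
Hypothesis QE : Q = \prod_(h <- hs) hform h.
Hypothesis two_neq0 : (2%:R : R) != 0.

Lemma divides_arrangement f :
  {in hs, forall h, hsubst h f = 0} -> divides Q f.
Proof.
move=> f0; rewrite QE; apply: divides_prod hs_uniq _ _ => [h h' a hh hh' hh'_neq|h hh].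
  rewrite -!hsubst_eq0P ?hs_proper // rmorphM => /eqP; rewrite mulf_eq0.
  by rewrite (negPf (hsubst_hform_neq0 _ _ _)) ?hs_normal // => /eqP.
by rewrite -hsubst_eq0P ?f0 ?hs_proper.
Qed.

Lemma arrangement_factor h : h \in hs ->
  exists2 Q', Q = hform h * Q' & hsubst h Q' != 0.
Proof.
move=> hh; exists (\prod_(h' <- rem h hs) hform h'); first by rewrite QE (big_rem h).
rewrite rmorph_prod prodf_seq_neq0; apply/allP => h' /=.
rewrite mem_rem_uniq // !inE => /andP[h'h h'hs].
by rewrite hsubst_hform_neq0 ?hs_normal // eq_sym.
Qed.

(* theta preserves Q S iff the columns of its symmetric coefficient matrix are
   logarithmic derivations: Q | theta(Q f) is tested at f = 1 and f = x_j. *)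
Lemma order2_logarithmicP :
  (forall f, divides Q (order2 (Q * f))) <->
  (forall j, {in hs, forall h, hsubst h (g h.1.1 j - h.2%:MP * g h.1.2 j) = 0}).
Proof.
split=> [logQ j h hh|tg f].
  have [Q' QQ' Q'0] := arrangement_factor hh.
  have [a aE] := logQ 1; have [b bE] := logQ 'X_j.
  have derQ : column_der j Q *+ 2 = Q * (b - a * 'X_j - order2 'X_j).
    rewrite mulr1 in aE; rewrite !mulrBr -bE mulrA -aE order2M.
    rewrite (bigD1 j) //= big1 ?addr0 => [|i ij]; last first.
      by rewrite mderivX mnm1E eq_sym (negPf ij) scale0r mulr0.
    have -> : ('X_j : S)^`M(j) = 1.
      by rewrite mderivX mnm1E eqxx scale1r -{1}[U_(j)%MM]add0m addmK mpolyX0.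
    by rewrite mulr1; ring.
  have := congr1 (hsubst h) derQ.
  rewrite rmorphMn rmorphM [in RHS]QQ' rmorphM hsubst_hform ?hs_proper // !mul0r.
  rewrite -scaler_nat -mul_mpolyC => /eqP; rewrite mulf_eq0 mpolyC_eq0.
  rewrite (negPf two_neq0) QQ' column_derM rmorphD !rmorphM.
  rewrite hsubst_hform ?hs_proper // mul0r addr0 mulf_eq0 (negPf Q'0) orbF.
  by rewrite column_der_hform => /eqP.
apply: divides_arrangement => h hh; have [Q' -> _] := arrangement_factor hh.
rewrite -mulrA order2M order2_hform mul0r add0r rmorphD rmorphMn rmorphM.
rewrite hsubst_hform ?hs_proper // mul0r addr0 raddf_sum big1 ?mul0rn //= => j _.
by rewrite rmorphM column_der_hform tg // mul0r.
Qed.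

End SecondOrder.

Section PairIndices.
Variable l : nat.
Implicit Types i j k : 'I_l.

Lemma mdeg_pair i j : mdeg (U_(i) + U_(j))%MM = 2%N.
Proof. by rewrite mdegD !mdeg1. Qed.

Definition midx2 i j : midx l 2 :=
  exist _ (BMultinom (eq_leq (congr1 succn (mdeg_pair i j))))
    (introT eqP (mdeg_pair i j)).

Lemma mexp_midx2 i j : mexp (midx2 i j) = (U_(i) + U_(j))%MM.
Proof. by []. Qed.

Lemma midx_inj m : injective (@mexp l m).
Proof. by move=> a b ab; do 2!apply: val_inj. Qed.

Lemma midx2P (a : midx l 2) : exists i j, a = midx2 i j.
Proof.
have a2 : mdeg (mexp a) = 2%N := eqP (valP a).
have [i ai] : exists i, mexp a i != 0%N.
  apply/existsP; apply: contra_eqT a2; rewrite negb_exists => /forallP a0.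
  by rewrite mdegE big1 // => i _; apply/eqP; rewrite -[_ == _]negbK a0.
have := a2; rewrite -(@submK _ U_(i)%MM (mexp a)) ?lep1mP // mdegD mdeg1 addn1.
move=> [/eqP]; case/mdeg1P => j /eqP aj; exists i, j; apply: midx_inj.
by rewrite mexp_midx2 addmC -aj submK // lep1mP.
Qed.

Lemma eq_midx2 i j i' j' : (midx2 i j == midx2 i' j') =
  ((i, j) == (i', j')) || ((i, j) == (j', i')).
Proof.
rewrite !xpair_eqE; apply/eqP/orP => [/(congr1 (@mexp _ _))|]; last first.
  case=> /andP[/eqP -> /eqP ->] //; apply: midx_inj.
  by rewrite !mexp_midx2 addmC.
rewrite !mexp_midx2 => E.
have := congr1 (fun m : 'X_{1..l} => m i) E; rewrite /= !mnmDE !mnm1E eqxx.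
case: (eqVneq i' i) E => [-> /addmI/eqP|_ E]; first by rewrite eq_mnm1; left.
case: (eqVneq j' i) E => [-> |//].
by rewrite [RHS]addmC => /addmI/eqP; rewrite eq_mnm1; right.
Qed.

Lemma midx2C i j : midx2 i j = midx2 j i.
Proof. by apply/eqP; rewrite eq_midx2 eqxx orbT. Qed.

Lemma mfact_midx2 i j : mfact (midx2 i j) = if i == j then 2 else 1%N.
Proof.
have factE k : ((U_(i) + U_(j))%MM k)`! = if (i == j) && (i == k) then 2 else 1%N.
  by rewrite mnmDE !mnm1E; case: (eqVneq i j) => [<-|ij]; [case: eqP|
    case: (eqVneq i k) ij => [<-|_ _]; [rewrite eq_sym => /negPf ->|case: eqP]].
rewrite /mfact mexp_midx2 (eq_bigr _ (fun k _ => factE k)).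
case: eqP => _ /=; last by rewrite big1.
rewrite (bigD1 i) //= eqxx big1 ?muln1 // => k.
by rewrite eq_sym => /negPf ->.
Qed.

Lemma card_midx2 (a : midx l 2) :
  (mfact a * #|[pred p : 'I_l * 'I_l | midx2 p.1 p.2 == a]|)%N = 2%N.
Proof.
have [i [j ->]] := midx2P a; rewrite mfact_midx2.
have -> : #|[pred p : 'I_l * 'I_l | midx2 p.1 p.2 == midx2 i j]| =
          #|[set (i, j); (j, i)]|.
  by apply: eq_card => -[i' j']; rewrite !inE eq_midx2.
by rewrite cards2 xpair_eqE [j == i]eq_sym andbb; case: eqP.
Qed.

End PairIndices.

Section CoefficientMatrix.
Variables (R : realType) (l : nat).
Local Notation S := {mpoly R[l]}.
Local Notation dop := (dop R l 2).
Implicit Types th : dop.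

(* theta = 1/2 \sum_(i, j) (coefmx theta i j) d_i d_j *)
Definition coefmx th i j : S := (mfact (midx2 i j))%:R * th (midx2 i j).

Lemma mfact_neq0 (a : midx l 2) : (mfact a)%:R != 0 :> R.
Proof.
by have [i [j ->]] := midx2P a; rewrite mfact_midx2; case: ifP; rewrite pnatr_eq0.
Qed.

Lemma coefmxC th i j : coefmx th i j = coefmx th j i.
Proof. by rewrite /coefmx midx2C. Qed.

Lemma natr_mpolyZ n (p : S) : n%:R * p = (n%:R : R) *: p.
Proof. by rewrite mulr_natl scaler_nat. Qed.

Lemma coefmxK th i j :
  (th (midx2 i j) : S) = ((mfact (midx2 i j))%:R^-1 : R) *: coefmx th i j.
Proof.
by rewrite /coefmx natr_mpolyZ scalerA mulVf ?scale1r ?mfact_neq0.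
Qed.

Lemma coefmx_inj th th' : (forall i j, coefmx th i j = coefmx th' i j) -> th = th'.
Proof.
move=> eq_th; apply: dopP => a; have [i [j ->]] := midx2P a.
by rewrite [LHS]coefmxK [RHS]coefmxK eq_th.
Qed.

Lemma coefmx0 i j : coefmx 0 i j = 0.
Proof. by rewrite /coefmx ffunE mulr0. Qed.

Lemma coefmx_sum (I : finType) (c : I -> S) (b : I -> dop) i j :
  coefmx (\sum_x c x *: b x) i j = \sum_x c x * coefmx (b x) i j.
Proof.
rewrite /coefmx sum_ffunE mulr_sumr; apply: eq_bigr => x _.
by rewrite ffunE mulrCA.
Qed.

Lemma dop_apply_order2 th f : dop_apply th f *+ 2 = order2 (coefmx th) f.
Proof.
rewrite /order2 pair_bigA.
rewrite (partition_big (fun p : 'I_l * 'I_l => midx2 p.1 p.2) xpredT) //.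
rewrite /dop_apply -sumrMnl; apply: eq_bigr => a _.
rewrite (eq_bigr (fun=> (mfact a)%:R * (th a * f^`M[mexp a]))) => [|p /eqP <-].
  pose A := [pred p : 'I_l * 'I_l | midx2 p.1 p.2 == a].
  rewrite (eq_bigl (mem A)) => [|p]; last by rewrite inE.
  by rewrite sumr_const [X in _ = X *+ _]mulr_natl -mulrnA card_midx2.
by rewrite mexp_midx2 mderivmDm !mderivmU1m /coefmx mulrA.
Qed.

Lemma Dmod_order2 Q th :
  Dmod 2 Q th <-> forall f, divides Q (order2 (coefmx th) (Q * f)).
Proof.
split=> dvd f; have [g gE] := dvd f; last first.
  exists ((2%:R^-1 : R) *: g); rewrite -scalerAr -gE -dop_apply_order2.
  by rewrite -scaler_nat scalerA mulVf ?scale1r // pnatr_eq0.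
by exists (g *+ 2); rewrite -dop_apply_order2 gE mulrnAr.
Qed.

Lemma Dmod_tangent (hs : seq (hyperplane R l)) Q th :
  uniq hs -> {in hs, forall h, normal_hyperplane h} ->
  Q = \prod_(h <- hs) hform h ->
  Dmod 2 Q th <-> forall j, {in hs, forall h,
    hsubst h (coefmx th h.1.1 j - h.2%:MP * coefmx th h.1.2 j) = 0}.
Proof.
move=> hs_uniq hs_normal QE; rewrite Dmod_order2.
by apply: order2_logarithmicP => //; [apply: coefmxC | rewrite pnatr_eq0].
Qed.

Lemma coefmx_dop_pow (f : S) k i j :
  coefmx (dop_pow 2 f k) i j = if (i == k) && (j == k) then f else 0.
Proof.
rewrite /coefmx ffunE mexp_midx2.
have U2 : (U_(k) *+ 2)%MM = mexp (midx2 k k).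
  by rewrite mexp_midx2 mulmS mulm1n.
rewrite U2 -mexp_midx2 (inj_eq (@midx_inj _ _)) eq_midx2 orbb xpair_eqE.
case: andP => [[/eqP -> /eqP ->]|_]; last by rewrite mulr0.
rewrite mfact_midx2 eqxx natr_mpolyZ scalerA divff ?scale1r //.
by rewrite pnatr_eq0.
Qed.

Lemma xpoint_midx2 i j :
  (xpoint R (midx2 i j) = [:: 'X_i; 'X_j] :> seq S) \/
  (xpoint R (midx2 i j) = [:: 'X_j; 'X_i] :> seq S).
Proof.
set L := flatten [seq nseq (mexp (midx2 i j) k) ('X_k : S) | k <- enum 'I_l].
have permL : perm_eq L [:: 'X_i; 'X_j].
  apply/seq.permP => p; rewrite /L count_flatten -map_comp sumnE big_map big_enum /=.
  under eq_bigr do rewrite count_nseq mexp_midx2 mnmDE !mnm1E mulnDr.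
  rewrite big_split /= addn0; congr (_ + _)%N.
    rewrite (bigD1 i) //= eqxx muln1 big1 ?addn0 // => k.
    by rewrite eq_sym => /negPf ->; rewrite muln0.
  rewrite (bigD1 j) //= eqxx muln1 big1 ?addn0 // => k.
  by rewrite eq_sym => /negPf ->; rewrite muln0.
have -> : xpoint R (midx2 i j) = L :> seq S.
  have szL : size L = 2 by rewrite (perm_size permL).
  apply: (@eq_from_nth _ 0) => [|k]; rewrite size_tuple // => k2.
  by rewrite -[k]/(val (Ordinal k2)) -tnth_nth tnth_mktuple.
move: permL; case: L => [|a [|b [|c s]]] permL; try by have := perm_size permL.
have : a \in [:: 'X_i; 'X_j] by rewrite -(perm_mem permL) inE eqxx.
rewrite !inE => /orP[] /eqP aE; subst a.
  by move: permL; rewrite perm_cons => /perm_small_eq-> //; left.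
right; move: permL; rewrite perm_sym -[[:: 'X_i; _]]/([:: 'X_i] ++ [:: 'X_j]) perm_catC.
by rewrite perm_cons perm_sym => /perm_small_eq->.
Qed.

Lemma coefmx_dop_schur (s : {mpoly R[2]}) i j :
  coefmx (dop_schur l s) i j = s \mPo xpoint R (midx2 i j).
Proof.
by rewrite /coefmx ffunE natr_mpolyZ scalerA divff ?scale1r ?mfact_neq0.
Qed.

End CoefficientMatrix.

Section SchurPolynomials.
Variable R : realType.
Local Notation S2 := {mpoly R[2]}.

Lemma mpquot_eq (p q s : S2) : q != 0 -> s * q = p -> mpquot p q = s.
Proof.
move=> q0 sqp; apply: xget_unique => // s' /= s'q.
by apply: (mulIf q0); rewrite s'q.
Qed.

Lemma det_mx2 (A : comNzRingType) (M : 'M[A]_2) :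
  \det M = M ord0 ord0 * M ord_max ord_max - M ord0 ord_max * M ord_max ord0.
Proof.
rewrite (expand_det_row _ ord0) !big_ord_recl big_ord0 addr0 /cofactor !det_mx11.
rewrite !mxE /= /bump /= expr0 mul1r expr1 mulN1r mulrN.
by congr (_ * M _ _ - M _ _ * M _ _); apply: val_inj.
Qed.

Lemma mpolyX_sub_neq0 (i j : 'I_2) n : i != j -> (0 < n)%N ->
  'X_i ^+ n - 'X_j ^+ n != 0 :> S2.
Proof.
move=> ij n0; apply/eqP => /(congr1 (mcoeff (U_(i) *+ n)%MM)) /eqP.
have /negPf ne : (U_(j) *+ n)%MM != (U_(i) *+ n)%MM.
  apply/eqP => /(congr1 (fun m : 'X_{1..2} => m i)) /eqP.
  apply/negP; rewrite /= !mulmnE !mnm1E eqxx [j == i]eq_sym (negPf ij).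
  by rewrite mul1n eq_sym -lt0n.
by rewrite mcoeff0 mcoeffB !mcoeffXn eqxx ne subr0 oner_eq0.
Qed.

Variable la : 'I_2 -> nat.
Hypothesis la_le : (la ord_max <= la ord0)%N.

Lemma schurA_schur2 :
  schurA R la = schur2 (la ord0) (la ord_max) 'X_ord0 'X_ord_max.
Proof.
apply: mpquot_eq; rewrite !det_mx2 !mxE /= ?subn0 ?subnn ?addn1 ?addn0
  ?expr0 ?mulr1 ?mul1r; first by apply: mpolyX_sub_neq0.
by rewrite mulrC !expr1 mul_sub_schur2.
Qed.

Lemma schurB_schur2 : schurB R la = 'X_ord0 * 'X_ord_max *
  schur2 (la ord0) (la ord_max) ('X_ord0 ^+ 2) ('X_ord_max ^+ 2).
Proof.
apply: mpquot_eq; rewrite !det_mx2 !mxE /= ?muln0 ?expr0 ?mulr1 ?mul1r.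
  by apply: mpolyX_sub_neq0.
have E := mul_sub_schur2 ('X_ord0 ^+ 2 : S2) ('X_ord_max ^+ 2) la_le.
rewrite -[(2 * (2 - 1))%N]/2%N; move: E; set s := schur2 _ _ _ _ => E.
transitivity ('X_ord0 * 'X_ord_max * (('X_ord0 ^+ 2 - 'X_ord_max ^+ 2) * s)).
  by ring.
rewrite E -!exprM.
by rewrite subnn -[(2 - 1)%N]/1%N !addn1 !addn0 !exprS; ring.
Qed.

End SchurPolynomials.

Section ThetaCoefficients.
Variables (R : realType) (N : nat).
Local Notation l := N.+1.
Local Notation S := {mpoly R[l]}.
Variable la : Lambda l.
Local Notation a := (part la ord0).
Local Notation b := (part la ord_max).

Lemma xpoint_eval (F : S -> S -> S) (s : {mpoly R[2]}) i j :
  (forall t u, F t u = F u t) ->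
  (forall t : 2.-tuple S, s \mPo t = F (tnth t ord0) (tnth t ord_max)) ->
  s \mPo xpoint R (midx2 i j) = F 'X_i 'X_j.
Proof.
move=> FC ->; rewrite !(tnth_nth 0) /=.
by have [-> | ->] := xpoint_midx2 R i j; rewrite //= FC.
Qed.

Lemma comp_mpolyX_tnth (t : 2.-tuple S) i : ('X_i : {mpoly R[2]}) \mPo t = tnth t i.
Proof. by rewrite comp_mpolyXU -tnth_nth. Qed.

Lemma comp_mpoly_schur2 (t : 2.-tuple S) m n (p q : {mpoly R[2]}) :
  schur2 m n p q \mPo t = schur2 m n (p \mPo t) (q \mPo t).
Proof. exact: (rmorph_schur2 (comp_mpoly t)). Qed.

Lemma coefmx_thetaA i j :
  coefmx (thetaA R l (part la)) i j =
  schur_form (fun i => 'X_i) (fun=> 1) a b i j.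
Proof.
rewrite coefmx_dop_schur schurA_schur2 ?part_le // /schur_form !mul1r.
apply: xpoint_eval => [t u|t]; first exact: schur2C.
by rewrite comp_mpoly_schur2 !comp_mpolyX_tnth.
Qed.

Lemma coefmx_thetaB i j :
  coefmx (thetaB R l (part la)) i j =
  schur_form (fun i => 'X_i ^+ 2) (fun i => 'X_i) a b i j.
Proof.
rewrite coefmx_dop_schur schurB_schur2 ?part_le // /schur_form.
apply: (xpoint_eval (F := fun t u => t * u * schur2 a b (t ^+ 2) (u ^+ 2))).
  by move=> t u; rewrite schur2C [t * u]mulrC.
move=> t; rewrite !rmorphM /= comp_mpoly_schur2 !rmorphXn /=.
by rewrite !comp_mpolyX_tnth.
Qed.

End ThetaCoefficients.

Section TangentBasis.
Variables (R : realType) (N : nat).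
Local Notation l := N.+1.
Local Notation S := {mpoly R[l]}.
Variables (hs : seq (hyperplane R l)) (Q : S) (y w : 'I_l -> S).
Local Notation T := {h | h \in hs}.

Definition arr_tangent : ('I_l -> S) -> Prop :=
  tangent (fun h : T => hsubst (val h)) (fun h => (val h).1.1)
    (fun h => (val h).1.2) (fun h => (val h).2%:MP).

Lemma arr_tangentP v : arr_tangent v -> forall h, h \in hs ->
  hsubst h (v h.1.1 - h.2%:MP * v h.1.2) = 0.
Proof. by move=> tv h hh; apply: (tv (exist _ h hh)). Qed.

Hypothesis hs_uniq : uniq hs.
Hypothesis hs_normal : {in hs, forall h, normal_hyperplane h}.
Hypothesis QE : Q = \prod_(h <- hs) hform h.
Hypothesis y_inj : injective y.
Hypothesis w_neq0 : forall i, w i != 0.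
Hypothesis tangent_poly : forall v, arr_tangent v ->
  exists2 p : {poly S}, (size p <= N.+1)%N & forall i, v i = w i * p.[y i].
Hypothesis hsubst_y : forall h, h \in hs -> hsubst h (y h.1.1) = hsubst h (y h.1.2).
Hypothesis hsubst_w : forall h, h \in hs ->
  hsubst h (w h.1.1) = h.2%:MP * hsubst h (w h.1.2).
Hypothesis hsubst_y_neq : forall h i, i != h.1.1 -> hsubst h (y i) = y i.
Hypothesis hsubst_w_neq : forall h i, i != h.1.1 -> hsubst h (w i) = w i.

Lemma poly_arr_tangent (p : {poly S}) : arr_tangent (fun i => w i * p.[y i]).
Proof.
case=> h hh /=; rewrite rmorphB !rmorphM hsubst_w // hsubstC -!horner_map.
by rewrite hsubst_y // mulrA subrr.
Qed.

Lemma tangent_basis (b : 'I_l + Lambda l -> dop R l 2) :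
  (forall k i j, coefmx (b (inl k)) i j =
     if i == k then diag_form y w 1 i j else 0) ->
  (forall la i j, coefmx (b (inr la)) i j =
     schur_form y w (part la ord0) (part la ord_max) i j) ->
  is_basis (Dmod 2 Q) b.
Proof.
move=> bl br.
have DmodP th : Dmod 2 Q th <-> forall j, arr_tangent (coefmx th ^~ j).
  rewrite (Dmod_tangent _ hs_uniq hs_normal QE); split=> tg j.
    by case=> h hh; apply: tg.
  exact: arr_tangentP (tg j).
have phi_y h : {in [pred i | i != (val (h : T)).1.1] &,
    injective (hsubst (val h) \o y)}.
  by move=> i j; rewrite !inE => ik jk /=; rewrite !hsubst_y_neq // => /y_inj.
have phi_w (h : T) i : i != (val h).1.1 -> hsubst (val h) (w i) != 0.
  by move=> ik; rewrite hsubst_w_neq.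
have combE (c : 'I_l + Lambda l -> S) i j :
    coefmx (\sum_x c x *: b x) i j =
    \sum_la c (inr la) * schur_form y w (part la ord0) (part la ord_max) i j +
    diag_form y w (c (inl i)) i j.
  rewrite coefmx_sum big_sumType /= [LHS]addrC.
  congr (_ + _).
    by apply: eq_bigr => la _; rewrite br.
  rewrite (bigD1 i) //= bl eqxx big1 ?addr0 => [|k ki]; last first.
    by rewrite bl eq_sym (negPf ki) mulr0.
  by rewrite /diag_form; case: eqP => _; rewrite ?mulr0 // mul1r.
split.
- case=> [k|la]; apply/DmodP => j.
    have := diag_form_tangent poly_arr_tangent (if j == k then 1 else 0) j.
    apply: tangent_ext => i; rewrite bl /diag_form.
    by case: (eqVneq i j) => [->|_]; case: ifP => //; rewrite mul0r.
  apply: tangent_ext (schur_form_tangent poly_arr_tangent _ _ j) => i.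
  by rewrite br.
- move=> th /DmodP tg.
  have [cf [e thE]] := symmetric_tangent_gen y_inj w_neq0 tangent_poly
    poly_arr_tangent phi_y phi_w (coefmxC th) tg.
  exists (fun x => match x with inl k => e k | inr la => cf la end).
  by apply: coefmx_inj => i j; rewrite combE thE.
- move=> c sum0.
  have comb0 i j := esym (combE c i j).
  have [cf0 e0] : (forall la, c (inr la) = 0) /\ (forall i, c (inl i) = 0).
    apply: (symmetric_tangent_free y_inj w_neq0) => i j.
    by rewrite comb0 sum0 coefmx0.
  by case.
Qed.

End TangentBasis.

Section HomogeneousForms.
Variables (R : realType) (N : nat).
Local Notation l := N.+1.
Local Notation S := {mpoly R[l]}.

Lemma dhomog_prod_const (I : Type) (r : seq I) (F : I -> S) d :
  (forall x, F x \is d.-homog) -> \prod_(x <- r) F x \is (d * size r).-homog.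
Proof.
move=> hF; elim: r => [|x r IHr]; first by rewrite big_nil muln0 dhomog1.
by rewrite big_cons mulnS; apply: dhomogM.
Qed.

Lemma dhomog_coefmx (th : dop R l 2) d :
  (forall i j, coefmx th i j \is d.-homog) -> forall a, (th a : S) \is d.-homog.
Proof.
move=> hth a; have [i [j ->]] := midx2P a.
by rewrite coefmxK; apply: rpredZ.
Qed.

Variables (y w : 'I_l -> S) (dy dw : nat).
Hypothesis hy : forall i, y i \is dy.-homog.
Hypothesis hw : forall i, w i \is dw.-homog.

Lemma dhomog_schur_form m n i j :
  schur_form y w m n i j \is (dw + dw + dy * (m + n)).-homog.
Proof.
apply: dhomogM; first exact: dhomogM.
rewrite /schur2 big_nat; apply: rpred_sum => k /andP[nk km].
have km' : (k <= m + n)%N by rewrite -ltnS (leq_trans km) // ltnS leq_addr.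
rewrite -[X in (dy * X)%N](subnKC km') mulnDr.
by apply: dhomogM; apply: dhomogMn.
Qed.

Lemma dhomog_diag_form i j : diag_form y w 1 i j \is (dw + dy * N).-homog.
Proof.
rewrite /diag_form; case: eqP => _; last exact: rpred0.
rewrite mul1r horner_others; apply: dhomogM => //.
rewrite (eq_bigl (mem (predC1 i))) // -big_enum.
have sz : size (enum (predC1 i)) = N by rewrite -cardE cardC1 card_ord.
have : \prod_(x <- enum (predC1 i)) (y i - y x)
    \is (dy * size (enum (predC1 i))).-homog.
  by apply: dhomog_prod_const => x; rewrite rpredB ?hy.
by rewrite sz.
Qed.

Lemma tangent_basis_homog (b : 'I_l + Lambda l -> dop R l 2) :
  (forall k i j, coefmx (b (inl k)) i j =
     if i == k then diag_form y w 1 i j else 0) ->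
  (forall la i j, coefmx (b (inr la)) i j =
     schur_form y w (part la ord0) (part la ord_max) i j) ->
  forall x a, (b x a : S) \is
    (if x is inr la then dw + dw + dy * psize la else dw + dy * N)%N.-homog.
Proof.
move=> bl br [k|la] a; apply: dhomog_coefmx => i j.
  by rewrite bl; case: eqP => _; [apply: dhomog_diag_form | apply: rpred0].
rewrite br /psize !big_ord_recl big_ord0 addn0.
have -> : lift ord0 ord0 = ord_max :> 'I_2 by apply: val_inj.
exact: dhomog_schur_form.
Qed.

End HomogeneousForms.

Lemma perm_codom_sum (I J : finType) (e : nat) (d : J -> nat) :
  perm_eq (codom (fun x : I + J => if x is inr j then d j else e))
    (nseq #|I| e ++ codom d).
Proof.
set f := fun x => _.
have -> : nseq #|I| e ++ codom d = map f (map inl (enum I) ++ map inr (enum J)).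
  rewrite map_cat -(map_comp f inl) -(map_comp f inr); congr (_ ++ _).
  by rewrite cardE; elim: (enum I) => //= _ s ->.
apply: perm_map; apply: uniq_perm; rewrite ?enum_uniq //.
  rewrite cat_uniq; apply/and3P; split.
  - by rewrite map_inj_uniq ?enum_uniq // => i i' [].
  - by apply/hasPn => _ /mapP[j _ ->]; apply/mapP => -[].
  - by rewrite map_inj_uniq ?enum_uniq // => j j' [].
move=> [i|j]; rewrite mem_enum mem_cat; apply/esym/orP; [left|right];
  by apply/mapP; eexists; rewrite ?mem_enum.
Qed.

Section Arrangements.
Variables (R : realType) (N : nat).
Local Notation l := N.+1.
Local Notation S := {mpoly R[l]}.

Definition diagonals (c : R) : seq (hyperplane R l) :=
  [seq (p, c) | p <- enum [pred p : 'I_l * 'I_l | (p.1 < p.2)%N]].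

Definition hyperplanesA := diagonals 1.

Definition hyperplanesB : seq (hyperplane R l) :=
  [seq (i, i, 0) | i <- enum 'I_l] ++ (diagonals 1 ++ diagonals (-1)).

Lemma mem_diagonals h c :
  (h \in diagonals c) = (h.1.1 < h.1.2)%N && (h.2 == c).
Proof.
case: h => p c'; apply/mapP/andP => /= [[q]|[p12 /eqP ->]].
  by rewrite mem_enum => q12 [-> ->].
by exists p; rewrite ?mem_enum.
Qed.

Lemma mem_hyperplanesB h : (h \in hyperplanesB) =
  [|| (h.1.1 == h.1.2) && (h.2 == 0), (h.1.1 < h.1.2)%N && (h.2 == 1)
    | (h.1.1 < h.1.2)%N && (h.2 == -1)].
Proof.
rewrite !mem_cat !mem_diagonals; congr (_ || _).
case: h => [[i j] c] /=; apply/mapP/andP => [[k _ [-> -> ->]]|[/eqP -> /eqP ->]].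
  by rewrite !eqxx.
by exists j; rewrite ?mem_enum.
Qed.

Lemma diagonals_uniq c : uniq (diagonals c).
Proof. by rewrite map_inj_uniq ?enum_uniq // => p q []. Qed.

Lemma one_neqN1 : (1 : R) != -1.
Proof. by rewrite -subr_eq0 opprK -mulr2n pnatr_eq0. Qed.

Lemma hyperplanesB_uniq : uniq hyperplanesB.
Proof.
rewrite !cat_uniq !diagonals_uniq map_inj_uniq ?enum_uniq /=; last by move=> i j [].
rewrite andbT; apply/andP; split; apply/hasPn => h.
  rewrite mem_cat !mem_diagonals => hh; apply/mapP => -[i _ hE].
  by move: hh; rewrite hE /= ltnn.
rewrite !mem_diagonals => /andP[-> /eqP ->] /=.
by rewrite eq_sym one_neqN1.
Qed.

Lemma hyperplanesA_normal : {in hyperplanesA, forall h, normal_hyperplane h}.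
Proof.
move=> h; rewrite mem_diagonals /normal_hyperplane => /andP[h12 /eqP ->].
by rewrite h12 oner_eq0; case: eqP h12 => // ->; rewrite ltnn.
Qed.

Lemma hyperplanesB_normal : {in hyperplanesB, forall h, normal_hyperplane h}.
Proof.
move=> h; rewrite mem_hyperplanesB /normal_hyperplane.
case/or3P => /andP[h12 /eqP ->]; first by rewrite h12 eqxx.
  by rewrite h12 oner_eq0; case: eqP h12 => // ->; rewrite ltnn.
by rewrite h12 oppr_eq0 oner_eq0; case: eqP h12 => // ->; rewrite ltnn.
Qed.

Lemma prod_diagonals c : \prod_(h <- diagonals c) hform h =
  \prod_(i < l) \prod_(j < l | (i < j)%N) ('X_i - c%:MP * 'X_j) :> S.
Proof. by rewrite big_map big_enum pair_big_dep. Qed.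

Lemma QAE : QA R l = \prod_(h <- hyperplanesA) hform h.
Proof.
rewrite prod_diagonals; apply: eq_bigr => i _; apply: eq_bigr => j _.
by rewrite mul1r.
Qed.

Lemma QBE : QB R l = \prod_(h <- hyperplanesB) hform h.
Proof.
rewrite !big_cat big_map big_enum !prod_diagonals; congr (_ * _) => /=.
  by apply: eq_bigr => i _; rewrite /hform /= mpolyC0 mul0r subr0.
rewrite -big_split; apply: eq_bigr => i _ /=; rewrite -big_split.
apply: eq_bigr => j _ /=; rewrite mpolyCN mpolyC1; ring.
Qed.

Lemma mpolyX_inj : injective (fun i : 'I_l => 'X_i : S).
Proof.
move=> i j /(congr1 (mcoeff U_(j))); rewrite !mcoeffXU eqxx.
by case: eqP => // _ /eqP; rewrite eq_sym oner_eq0.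
Qed.

Lemma mpolyX_neq0 (i : 'I_l) : 'X_i != 0 :> S.
Proof.
by apply/eqP => /(congr1 (mcoeff U_(i))) /eqP; rewrite mcoeffXU eqxx mcoeff0 oner_eq0.
Qed.

Lemma mpolyX_addN (i j : 'I_l) : 'X_i + 'X_j != 0 :> S.
Proof.
apply/eqP => /(congr1 (mcoeff U_(i))) /eqP; rewrite mcoeffD !mcoeffXU eqxx mcoeff0.
by rewrite -natrD pnatr_eq0.
Qed.

Lemma mpolyX2_inj : injective (fun i : 'I_l => 'X_i ^+ 2 : S).
Proof.
move=> i j /eqP; rewrite -subr_eq0 subr_sqr mulf_eq0 (negPf (mpolyX_addN i j)).
by rewrite orbF subr_eq0 => /eqP /mpolyX_inj.
Qed.

Lemma proper_diff (i k : 'I_l) (c : R) : i != k -> proper_hyperplane (i, k, c).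
Proof. by rewrite /proper_hyperplane => ->. Qed.

Lemma tangent_swap (v : 'I_l -> S) (c : R) : c * c = 1 ->
  (forall k j : 'I_l, (k < j)%N -> hsubst (k, j, c) (v k - c%:MP * v j) = 0) ->
  forall k j, k != j -> hsubst (k, j, c) (v k - c%:MP * v j) = 0.
Proof.
move=> cc tv k j; rewrite neq_ltn => /orP[/tv//|jk].
have /hsubst_eq0P[|g gE] := tv _ _ jk; first by apply: proper_diff; rewrite neq_ltn jk.
apply/hsubst_eq0P; first by apply: proper_diff; rewrite neq_ltn jk orbT.
have ccM : c%:MP * c%:MP = 1 :> S by rewrite -mpolyCM cc mpolyC1.
exists g; transitivity (- c%:MP * (v j - c%:MP * v k)).
  by rewrite -[v k in LHS]mul1r -ccM; ring.
rewrite gE /hform mulrA; congr (_ * _) => /=.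
by rewrite -['X_k in RHS]mul1r -ccM; ring.
Qed.

Lemma tangentA_poly v : arr_tangent hyperplanesA v ->
  exists2 p : {poly S}, (size p <= l)%N & forall i, v i = 1 * p.['X_i].
Proof.
move=> tv.
have tv' (k j : 'I_l) : (k < j)%N -> hsubst (k, j, 1) (v k - 1%:MP * v j) = 0.
  move=> kj; have hh : (k, j, 1) \in hyperplanesA by rewrite mem_diagonals kj eqxx.
  exact: (arr_tangentP tv hh).
have XE (n i : 'I_l) : 'X_n - 'X_i = hform (n, i, 1) :> S.
  by rewrite /hform /= mpolyC1 mul1r.
have [| |p szp pE] := @newton_interpolation _ _ (enum 'I_l)
  (fun i => 'X_i : S) v (enum_uniq _).
- move=> n i k a ni nk ik; rewrite !XE -!hsubst_eq0P ?proper_diff //.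
  rewrite rmorphM hsubst_hformE !hsubstX /= eqxx [k == n]eq_sym (negPf nk).
  rewrite mpolyC1 !mul1r => /eqP; rewrite mulf_eq0 subr_eq0.
  by rewrite (inj_eq mpolyX_inj) (negPf ik) => /eqP.
- move=> i j; case: (eqVneq i j) => [->|ij]; first by exists 0; rewrite mulr0 subrr.
  rewrite XE -hsubst_eq0P ?proper_diff // -[v j]mul1r -mpolyC1.
  by apply: tangent_swap => //; rewrite mulr1.
rewrite size_enum_ord in szp.
by exists p => // i; rewrite mul1r pE ?mem_enum.
Qed.

Lemma divides_sqrP (i k : 'I_l) (f : S) : i != k ->
  divides ('X_i ^+ 2 - 'X_k ^+ 2) f <->
  hsubst (i, k, 1) f = 0 /\ hsubst (i, k, -1) f = 0.
Proof.
move=> ik; have sqrE : 'X_i ^+ 2 - 'X_k ^+ 2 = hform (i, k, 1) * hform (i, k, -1) :> S.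
  by rewrite /hform /= mpolyCN mpolyC1; ring.
have hform0 (c : R) : hsubst (i, k, c) (hform (i, k, c)) = 0.
  by rewrite hsubst_hform ?proper_diff.
rewrite sqrE; split=> [[g ->]|[]].
  split; first by rewrite -mulrA rmorphM hform0 mul0r.
  by rewrite [hform _ * hform _]mulrC -mulrA rmorphM hform0 mul0r.
move=> /hsubst_eq0P[|g ->]; first exact: proper_diff.
rewrite rmorphM => /eqP; rewrite mulf_eq0 => /orP[|/eqP].
  rewrite hsubst_hformE !hsubstX /= eqxx [k == i]eq_sym (negPf ik).
  rewrite mpolyCN mpolyC1 mulN1r mul1r -opprD oppr_eq0.
  by rewrite (negPf (mpolyX_addN _ _)).
move=> /hsubst_eq0P[|g' ->]; first exact: proper_diff.
by exists g'; rewrite mulrA.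
Qed.

Lemma tangentB_poly v : arr_tangent hyperplanesB v ->
  exists2 p : {poly S}, (size p <= l)%N & forall i, v i = 'X_i * p.['X_i ^+ 2].
Proof.
move=> tv.
have tv' c k j : c * c = 1 -> k != j -> hsubst (k, j, c) (v k - c%:MP * v j) = 0.
  move=> cc; apply: tangent_swap => // {}k {}j kj.
  have hh : (k, j, c) \in hyperplanesB.
    rewrite mem_hyperplanesB kj /= -eqf_sqr expr1n expr2 cc eqxx orbT //.
  exact: (arr_tangentP tv hh).
have /fin_all_exists[u uE] i : exists u, v i = 'X_i * u.
  have hh : (i, i, 0) \in hyperplanesB by rewrite mem_hyperplanesB !eqxx.
  have : hsubst (i, i, 0 : R) (v i - 0%:MP * v i) = 0 := arr_tangentP tv hh.
  rewrite mpolyC0 mul0r subr0 => /hsubst_eq0P[|g ->].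
    by rewrite /proper_hyperplane /= !eqxx.
  by exists g; rewrite /hform /= mpolyC0 mul0r subr0.
have cong i j : divides ('X_i ^+ 2 - 'X_j ^+ 2) (u i - u j).
  case: (eqVneq i j) => [->|ij]; first by exists 0; rewrite mulr0 subrr.
  have phi0 c : c * c = 1 -> c != 0 -> hsubst (i, j, c) (u i - u j) = 0.
    move=> cc c0; have := tv' c i j cc ij.
    rewrite !uE rmorphB !rmorphM hsubstC !hsubstX /= eqxx [j == i]eq_sym (negPf ij).
    rewrite mulrA -mulrBr -rmorphB => /eqP; rewrite !mulf_eq0 mpolyC_eq0 (negPf c0).
    by rewrite (negPf (mpolyX_neq0 _)) => /eqP.
  by apply/divides_sqrP => //; split; apply: phi0;
    rewrite ?mulr1 ?mulrNN ?mulr1 ?oppr_eq0 ?oner_eq0.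
have [| |p szp pE] := @newton_interpolation _ _ (enum 'I_l)
  (fun i => 'X_i ^+ 2 : S) u (enum_uniq _).
- move=> n i k a ni nk ik; rewrite !divides_sqrP //.
  have phiM c : c * c = 1 ->
      hsubst (n, i, c) (('X_n ^+ 2 - 'X_k ^+ 2) * a) = 0 -> hsubst (n, i, c) a = 0.
    move=> cc; rewrite rmorphM rmorphB !rmorphXn !hsubstX /= eqxx.
    rewrite [k == n]eq_sym (negPf nk) exprMn [c%:MP ^+ 2]expr2 -mpolyCM cc.
    rewrite mpolyC1 mul1r.
    move=> /eqP; rewrite mulf_eq0 subr_eq0 (inj_eq mpolyX2_inj) (negPf ik).
    by move=> /eqP.
  by case=> H1 H2; split; [apply: phiM H1 | apply: phiM H2];
    rewrite ?mulrNN mulr1.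
- exact: cong.
rewrite size_enum_ord in szp.
by exists p => // i; rewrite uE pE ?mem_enum.
Qed.

Lemma coefmx_CA_eta k i j : coefmx (@CA R l (inl k)) i j =
  if i == k then diag_form (fun i : 'I_l => 'X_i : S) (fun=> 1) 1 i j else 0.
Proof.
rewrite /= coefmx_dop_pow /diag_form horner_others !mul1r.
by case: (eqVneq i k) => //= ->; rewrite eq_sym.
Qed.

Lemma coefmx_CB_eta k i j : coefmx (@CB R l (inl k)) i j =
  if i == k
  then diag_form (fun i : 'I_l => 'X_i ^+ 2 : S) (fun i => 'X_i) 1 i j else 0.
Proof.
rewrite /= coefmx_dop_pow /diag_form horner_others mul1r.
by case: (eqVneq i k) => //= ->; rewrite eq_sym.
Qed.

Lemma basisA : is_basis (Dmod 2 (QA R l)) (@CA R l).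
Proof.
apply: (tangent_basis (diagonals_uniq 1) hyperplanesA_normal QAE mpolyX_inj
  _ tangentA_poly) => [i|h|h|h i hi|h i hi||].
- exact: oner_neq0.
- rewrite mem_diagonals => /andP[h12 /eqP h1].
  by rewrite /= !hsubstX eqxx h1 mpolyC1 mul1r -[h.1.2 == _]val_eqE gtn_eqF.
- rewrite mem_diagonals => /andP[h12 /eqP h1].
  by rewrite h1 mpolyC1 mul1r !rmorph1.
- by rewrite /= hsubstX (negPf hi).
- by rewrite rmorph1.
- exact: coefmx_CA_eta.
- exact: coefmx_thetaA.
Qed.

Lemma basisB : is_basis (Dmod 2 (QB R l)) (@CB R l).
Proof.
apply: (tangent_basis hyperplanesB_uniq hyperplanesB_normal QBE mpolyX2_inj
  mpolyX_neq0 tangentB_poly) => [h|h|h i hi|h i hi||].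
- rewrite mem_hyperplanesB /= !rmorphXn !hsubstX eqxx.
  case/or3P => /andP[h12 /eqP ->].
  + by rewrite -(eqP h12) eqxx.
  + by rewrite -[h.1.2 == _]val_eqE gtn_eqF // mpolyC1 mul1r.
  + by rewrite -[h.1.2 == _]val_eqE gtn_eqF // mpolyCN mpolyC1 mulN1r sqrrN.
- rewrite mem_hyperplanesB /= !hsubstX eqxx.
  case/or3P => /andP[h12 /eqP h2E].
  + by rewrite h2E mpolyC0 !mul0r.
  + by rewrite -[h.1.2 == _]val_eqE gtn_eqF.
  + by rewrite -[h.1.2 == _]val_eqE gtn_eqF.
- by rewrite /= rmorphXn hsubstX (negPf hi).
- by rewrite /= hsubstX (negPf hi).
- exact: coefmx_CB_eta.
- exact: coefmx_thetaB.
Qed.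

Lemma expA : is_exp (Dmod 2 (QA R l))
  (nseq l (l - 1)%N ++ [seq psize la | la : Lambda l]).
Proof.
have hX (i : 'I_l) : ('X_i : S) \is 1.-homog by rewrite dhomogX; apply/eqP/mdeg1.
have h1 (i : 'I_l) : (1 : S) \is 0.-homog by apply: dhomog1.
apply: is_exp_basis basisA (tangent_basis_homog hX h1 coefmx_CA_eta _) _.
  exact: coefmx_thetaA.
have -> : nseq l (l - 1)%N = nseq #|'I_l| (0 + 1 * N)%N.
  by rewrite card_ord mul1n subn1.
have -> : [seq psize la | la : Lambda l] =
    codom (fun la : Lambda l => 0 + 0 + 1 * psize la)%N.
  by apply: eq_codom => la; rewrite mul1n.
exact: perm_codom_sum.
Qed.

Lemma expB : is_exp (Dmod 2 (QB R l))
  (nseq l (2 * l - 1)%N ++ [seq (2 * psize la + 2)%N | la : Lambda l]).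
Proof.
have hX (i : 'I_l) : ('X_i : S) \is 1.-homog by rewrite dhomogX; apply/eqP/mdeg1.
have hX2 (i : 'I_l) : ('X_i ^+ 2 : S) \is 2.-homog by apply: (dhomogMn 2 (hX i)).
apply: is_exp_basis basisB (tangent_basis_homog hX2 hX coefmx_CB_eta _) _.
  exact: coefmx_thetaB.
have -> : nseq l (2 * l - 1)%N = nseq #|'I_l| (1 + 2 * N)%N.
  by rewrite card_ord mulnS subn1.
have -> : [seq (2 * psize la + 2)%N | la : Lambda l] =
    codom (fun la : Lambda l => 1 + 1 + 2 * psize la)%N.
  by apply: eq_codom => la; rewrite addnC.
exact: perm_codom_sum.
Qed.

End Arrangements.

Theorem theorem4p4 (R : realType) (l : nat) (hl : (2 <= l)%N) :
  (is_basis (Dmod 2 (QA R l)) (@CA R l) /\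
   is_exp (Dmod 2 (QA R l))
     (nseq l (l - 1)%N ++ [seq psize la | la : Lambda l]))
  /\
  (is_basis (Dmod 2 (QB R l)) (@CB R l) /\
   is_exp (Dmod 2 (QB R l))
     (nseq l (2 * l - 1)%N ++ [seq (2 * psize la + 2)%N | la : Lambda l])).
Proof.
case: l hl => // N _.
by split; split; [exact: basisA | exact: expA | exact: basisB | exact: expB].
Qed.
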